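(* For each $k=1,\dots,N$ let the joint-smoothed distribution under the current parameters $\theta'$ be the Gaussian mixture $$p_{\theta'}(x_{k+1},z_{k+1},x_k,z_k\mid y_{1:N})=\sum_{j=1}^{M^{\mathrm S}_k}w^j_{k:k+1|N}(z_k,z_{k+1})\,\mathcal N\left(\begin{bmatrix} x_k \\ x_{k+1} \end{bmatrix}\Big|\ \mu^j_{k:k+1|N}(z_k,z_{k+1}),\mathbf P^j_{k:k+1|N}(z_k,z_{k+1})\right).$$ Then a parameter set $\theta$ (consisting of the initial distribution $p(x_1,z_1)$, the transition matrix $\mathbf T$, and $\{\boldsymbol\Gamma(z),\boldsymbol\Pi(z)\}_{z=1}^m$) that maximises $\theta\mapsto\mathcal Q(\theta,\theta')$ is given, for $z,z^*\in\{1,\dots,m\}$, by $$p(x_1,z_1)=p_{\theta'}(x_1,z_1\mid y_{1:N}),$$ $$\boldsymbol\Gamma(z)=\boldsymbol\Psi(z)\boldsymbol\Sigma^{-1}(z),$$ $$\boldsymbol\Pi(z)=\frac1{c_m(z)}\Big(\boldsymbol\Phi(z)-\boldsymbol\Gamma(z)\boldsymbol\Psi^T(z)-\boldsymbol\Psi(z)\boldsymbol\Gamma^T(z)+\boldsymbol\Gamma(z)\boldsymbol\Sigma(z)\boldsymbol\Gamma^T(z)\Big),$$ $$\mathbf T(z^*,z)=\frac{\sum_{k=1}^N\sum_{j=1}^{M^{\mathrm S}_k}w^j_{k:k+1|N}(z,z^* )}{c_m(z)},$$ where $$c_m(z)=\sum_{k=1}^N\sum_{j=1}^m\sum_{\ell=1}^{M^{\mathrm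 S}_k}w^\ell_{k:k+1|N}(z,j),$$ $$\boldsymbol\Sigma(z)=\sum_{k=1}^N\sum_{j=1}^m\sum_{\ell=1}^{M^{\mathrm S}_k}w^\ell_{k:k+1|N}(z,j)\,\mathbb E_k^{z,j,\ell}\left[\begin{bmatrix} X_k \\ u_k \end{bmatrix}\begin{bmatrix} X_k \\ u_k \end{bmatrix}^T\right],$$ $$\boldsymbol\Phi(z)=\sum_{k=1}^N\sum_{j=1}^m\sum_{\ell=1}^{M^{\mathrm S}_k}w^\ell_{k:k+1|N}(z,j)\,\mathbb E_k^{z,j,\ell}\left[\begin{bmatrix} y_k \\ X_{k+1} \end{bmatrix}\begin{bmatrix} y_k \\ X_{k+1} \end{bmatrix}^T\right],$$ $$\boldsymbol\Psi(z)=\sum_{k=1}^N\sum_{j=1}^m\sum_{\ell=1}^{M^{\mathrm S}_k}w^\ell_{k:k+1|N}(z,j)\,\mathbb E_k^{z,j,\ell}\left[\begin{bmatrix} y_k \\ X_{k+1} \end{bmatrix}\begin{bmatrix} X_k \\ u_k \end{bmatrix}^T\right].$$ Moreover, the updates may be applied to a reduced set of parameters: the formula for $\boldsymbol\Pi(z)$ remains optimal when $\boldsymbol\Gamma(z)$ is held at a fixed known value (with that value inserted), the formula for $\boldsymbol\Gamma(z)$ remains optimal when $\boldsymbol\Pi(z)$ is held fixed, $\mathbf T$ may be held fixed without changing the other updates, and the maximisation separates over the modes $z=1,\dots,m$, so that different modes may have different sets of unknown (or no unknown) parameters.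
   Context: Jump Markov linear system with modes $Z_k\in\{1,\dots,m\}$, states $X_k\in\mathbb R^{n_x}$, known inputs $u_k\in\mathbb R^{n_u}$ and observations $y_k\in\mathbb R^{n_y}$: $$X_{k+1}=\mathbf A(Z_k)X_k+\mathbf B(Z_k)u_k+V_k,\quad Y_k=\mathbf C(Z_k)X_k+\mathbf D(Z_k)u_k+E_k,$$ where, given $Z_k$, $(V_k,E_k)$ is zero-mean Gaussian white noise with $\mathrm{Cov}(V_k)=\mathbf Q(Z_k)$, $\mathrm{Cov}(E_k)=\mathbf R(Z_k)$, $\mathrm{Cov}(V_k,E_k)=\mathbf S(Z_k)$, and $Z_k$ is a Markov chain with $\mathbf T(j,i)=\mathbb P(Z_{k+1}=j\mid Z_k=i)$. Write $$\boldsymbol\Gamma(z)=\begin{bmatrix}\mathbf C(z)&\mathbf D(z) \\ \mathbf A(z)&\mathbf B(z)\end{bmatrix},\qquad \boldsymbol\Pi(z)=\begin{bmatrix}\mathbf R(z)&\mathbf S^T(z) \\ \mathbf S(z)&\mathbf Q(z)\end{bmatrix}.$$ The parameter $\theta$ comprises a density $p_\theta(x_1,z_1)$, the matrix $\mathbf T$ with nonnegative entries, arbitrary real matrices $\boldsymbol\Gamma(z)$, and symmetric positive definite $\boldsymbol\Pi(z)$. With data $y_{1:N},u_{1:N}$ fixed, the $\mathcal Q$-function is $$\mathcal Q(\theta,\theta')=\sum_{z_{1:N+1}}\int\ln\big(p_\theta(x_{1:N+1},z_{1:N+1},y_{1:N})\big)\,p_{\theta'}(x_{1:N+1},z_{1:N+1}\mid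 y_{1:N})\,dx_{1:N+1},$$ where $$\ln p_\theta(x_{1:N+1},z_{1:N+1},y_{1:N})=\ln p_\theta(x_1,z_1)+\sum_{k=1}^N\left[\ln\mathcal N\left(\begin{bmatrix} y_k \\ x_{k+1} \end{bmatrix}\Big|\ \boldsymbol\Gamma(z_k)\begin{bmatrix} x_k \\ u_k \end{bmatrix},\boldsymbol\Pi(z_k)\right)+\ln\frac{\mathbf T(z_{k+1},z_k)}{\sum_{\ell=1}^m\mathbf T(\ell,z_k)}\right];$$ the normalisation of $\mathbf T$ in the last term builds in the law of total probability. $\mathcal N(\cdot\mid\mu,\mathbf P)$ is the Gaussian density with mean $\mu$ and covariance $\mathbf P$. The joint-smoothed densities in the claim are the marginals of $p_{\theta'}(x_{1:N+1},z_{1:N+1}\mid y_{1:N})$. $\mathbb E_k^{z,j,\ell}[f(X_k,X_{k+1})]$ denotes the expectation of $f$ when $(X_k,X_{k+1})$ is Gaussian with mean $\mu^\ell_{k:k+1|N}(z,j)$ and covariance $\mathbf P^\ell_{k:k+1|N}(z,j)$; $u_k$ and $y_k$ are fixed known values. The formulas are understood in the case where they are well defined, i.e. $c_m(z)>0$, $\boldsymbol\Sigma(z)$ is invertible and the resulting $\boldsymbol\Pi(z)$ is positive definite. *)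

(* Defs.v *)
From HB Require Import structures.
From mathcomp Require Import all_boot all_order all_algebra.
From mathcomp Require Import all_classical all_reals all_analysis.

Set Implicit Arguments.
Unset Strict Implicit.
Unset Printing Implicit Defensive.

Import Order.TTheory GRing.Theory Num.Theory.
Import numFieldNormedType.Exports.

Local Open Scope classical_set_scope.
Local Open Scope ring_scope.

(** ** Powers of a sigma-finite measure, and Lebesgue measure on R^n *)

Section measure_power.
Context d (T : measurableType d) (R : realType).

Definition tcons n (p : T * n.-tuple T) : n.+1.-tuple T :=
  [the n.+1.-tuple T of p.1 :: p.2].

Lemma measurable_tcons n : measurable_fun [set: T * n.-tuple T] (@tcons n).
Proof. exact: (measurable_cons measurable_fst measurable_snd). Qed.

Lemma measurable_tuncons n : measurable_fun [set: n.+1.-tuple T]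
  (fun t => (thead t, [tuple of behead t]) : T * n.-tuple T).
Proof.
apply: measurable_fun_pair; last exact: measurable_behead.
exact: (@measurable_tnth _ T n.+1 ord0).
Qed.

Section cons_measure.
Context n (mu : {sigma_finite_measure set T -> \bar R})
  (nu : {sigma_finite_measure set (n.-tuple T) -> \bar R}).

Definition cons_measure : set (n.+1.-tuple T) -> \bar R :=
  pushforward (mu \x nu)%E (@tcons n).

Let cons_measure0 : (cons_measure set0 = 0)%E.
Proof. by rewrite /cons_measure /pushforward preimage_set0 measure0. Qed.

Let cons_measure_ge0 A : (0 <= cons_measure A)%E.
Proof. by rewrite /cons_measure /pushforward; exact: measure_ge0. Qed.

Let cons_measure_sigma_additive : semi_sigma_additive cons_measure.
Proof.
move=> F mF tF mUF; rewrite /cons_measure /pushforward preimage_bigcup.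
apply: measure_semi_sigma_additive.
- by move=> i; rewrite -[X in measurable X]setTI; exact: measurable_tcons.
- apply/trivIsetP => /= i j _ _ ij; rewrite -preimage_setI.
  by move/trivIsetP : tF => /(_ _ _ _ _ ij) ->//; rewrite preimage_set0.
- rewrite -preimage_bigcup -[X in measurable X]setTI.
  exact: measurable_tcons.
Qed.

HB.instance Definition _ := isMeasure.Build _ _ _ cons_measure
  cons_measure0 cons_measure_ge0 cons_measure_sigma_additive.

Let cons_measure_sigma_finite : sigma_finite setT cons_measure.
Proof.
have /sigma_finiteP[F [FT ndF Foo]] := sigma_finiteT mu.
have /sigma_finiteP[G [GT ndG Goo]] := sigma_finiteT nu.
pose g (t : n.+1.-tuple T) : T * n.-tuple T :=
  (thead t, [tuple of behead t]).
exists (fun i => g @^-1` (F i `*` G i)).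
  rewrite -preimage_bigcup (_ : \bigcup_i _ = setT) ?preimage_setT//.
  rewrite -subTset => -[a t] _.
  have : setT a by []. have : setT t by [].
  rewrite {1}FT {1}GT => -[j _ Gj] [i _ Fi]; exists (maxn i j) => //; split.
  - by move: (a) Fi; exact/subsetPset/ndF/leq_maxl.
  - by move: (t) Gj; exact/subsetPset/ndG/leq_maxr.
move=> i; have [mF muF] := Foo i; have [mG nuG] := Goo i; split.
  rewrite -[X in measurable X]setTI.
  by apply: measurable_tuncons => //; exact: measurableX.
rewrite /cons_measure /pushforward -comp_preimage.
rewrite (_ : g \o _ = id); last first.
  by apply/funext => -[a t] /=; rewrite /g /tcons/=; congr pair; exact/val_inj.
by rewrite preimage_id product_measure1E// lte_mul_pinfty// ge0_fin_numE.
Qed.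

HB.instance Definition _ := Measure_isSigmaFinite.Build _ _ _ cons_measure
  cons_measure_sigma_finite.

End cons_measure.

Fixpoint measure_power (mu : {sigma_finite_measure set T -> \bar R}) n :
    {sigma_finite_measure set (n.-tuple T) -> \bar R} :=
  if n is n'.+1 then cons_measure mu (measure_power mu n')
  else dirac ([tuple] : 0.-tuple T).

End measure_power.

(* R^n, as tuples of reals with the Borel product sigma-algebra. *)
Notation euclid R n := (n.-tuple (measurableTypeR R)).

Section gaussian.
Context (R : realType).

Definition leb n : {sigma_finite_measure set (euclid R n) -> \bar R} :=
  measure_power (@lebesgue_measure R) n.

Definition vec n (x : euclid R n) : 'cV[R]_n := \col_i (tnth x i : R).

Definition spd n (P : 'M[R]_n) : Prop :=
  P^T = P /\ forall v : 'cV[R]_n, v != 0 -> 0 < (v^T *m P *m v) ord0 ord0.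

Definition gauss n (x mu : 'cV[R]_n) (P : 'M[R]_n) : R :=
  (Num.sqrt ((2 * pi) ^+ n * \det P))^-1 *
  expR (- (((x - mu)^T *m invmx P *m (x - mu)) ord0 ord0 / 2)).

Definition pair_leb n := (leb n \x leb n)%E.

(* Expectation of F(X, X') when the stacked vector [X; X'] is N(mu, P). *)
Definition pair_expect n (mu : 'cV[R]_(n + n)) (P : 'M[R]_(n + n)) a b
    (F : 'cV[R]_n -> 'cV[R]_n -> 'M[R]_(a, b)) : 'M[R]_(a, b) :=
  \matrix_(i, j) \int[@pair_leb n]_p
    (F (vec p.1) (vec p.2) i j * gauss (col_mx (vec p.1) (vec p.2)) mu P).

End gaussian.

Section jump_markov_linear_system.
Context (R : realType) (nx nu ny m N : nat).

(* Tmx j i is P(Z_{k+1} = j | Z_k = i) up to the normalisation of column i;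
   Gam z = [C D; A B] and Pi z = [R S^T; S Q]. *)
Record params := Params {
  init : euclid R nx -> 'I_m -> R;
  Tmx : 'M[R]_m;
  Gam : 'I_m -> 'M[R]_(ny + nx, nx + nu);
  Pi : 'I_m -> 'M[R]_(ny + nx) }.

Definition is_density (p : euclid R nx -> 'I_m -> R) : Prop :=
  [/\ forall z, measurable_fun setT (p ^~ z),
      forall x z, 0 <= p x z &
      (\sum_z \int[leb R nx]_x (p x z)%:E = 1)%E].

Definition admissible (th : params) : Prop :=
  [/\ is_density (init th), forall j i, 0 <= Tmx th j i & forall z, spd (Pi th z)].

(* Times k = 1, ..., N are k : 'I_N; times 1, ..., N+1 are 'I_N.+1. *)
Definition cur (k : 'I_N) : 'I_N.+1 := widen_ord (leqnSn N) k.
Definition nxt (k : 'I_N) : 'I_N.+1 := lift ord0 k.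

Definition states := N.+1.-tuple (euclid R nx).
Definition modes := {ffun 'I_N.+1 -> 'I_m}.

Definition leb_states : {sigma_finite_measure set states -> \bar R} :=
  measure_power (leb R nx) N.+1.

Context (u : 'I_N -> 'cV[R]_nu) (y : 'I_N -> 'cV[R]_ny).

Definition xu k (x : 'cV[R]_nx) : 'cV[R]_(nx + nu) := col_mx x (u k).
Definition yx k (x : 'cV[R]_nx) : 'cV[R]_(ny + nx) := col_mx (y k) x.

Definition emission th (k : 'I_N) (x : states) (z : modes) : R :=
  gauss (yx k (vec (tnth x (nxt k))))
    (Gam th (z (cur k)) *m xu k (vec (tnth x (cur k)))) (Pi th (z (cur k))).

Definition transition th (k : 'I_N) (z : modes) : R :=
  Tmx th (z (nxt k)) (z (cur k)) / \sum_l Tmx th l (z (cur k)).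

(* p_theta(x_{1:N+1}, z_{1:N+1}, y_{1:N}) *)
Definition joint th (x : states) (z : modes) : R :=
  init th (tnth x ord0) (z ord0) *
  \prod_(k < N) (emission th k x z * transition th k z).

(* The extended logarithm is used so that ln 0 = -oo. *)
Definition ln_joint th (x : states) (z : modes) : \bar R :=
  (lne (init th (tnth x ord0) (z ord0))%:E +
   \sum_(k < N) (lne (emission th k x z)%:E + lne (transition th k z)%:E))%E.

(* p_theta(y_{1:N}) *)
Definition evidence th : \bar R :=
  (\sum_(z : modes) \int[leb_states]_x (joint th x z)%:E)%E.

(* p_theta(x_{1:N+1}, z_{1:N+1} | y_{1:N}) *)
Definition posterior th (x : states) (z : modes) : R :=
  joint th x z / fine (evidence th).

(* The integrand uses -oo * 0 = 0. *)
Definition Qfun (th th' : params) : \bar R :=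
  (\sum_(z : modes)
     \int[leb_states]_x (ln_joint th x z * (posterior th' x z)%:E))%E.

(* p_theta(x_1, z_1 | y_{1:N}) *)
Definition smoothed1 th (x1 : euclid R nx) (z1 : 'I_m) : R :=
  fine (\sum_(z : modes | z ord0 == z1)
    \int[measure_power (leb R nx) N]_xs (posterior th (tcons (x1, xs)) z)%:E)%E.

(* The joint-smoothed distribution
   P((X_k, X_{k+1}) \in A, Z_k = i, Z_{k+1} = j | y_{1:N}) *)
Definition joint_smoothed th (k : 'I_N) (i j : 'I_m)
    (A : set (euclid R nx * euclid R nx)) : \bar R :=
  (\sum_(z : modes | (z (cur k) == i) && (z (nxt k) == j))
     \int[leb_states]_(x in [set x | A (tnth x (cur k), tnth x (nxt k))])
       (posterior th x z)%:E)%E.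

(* In wgt, mean and cov, the mode arguments are z_k and then z_{k+1}. *)
Record mixtures := Mixtures {
  ncomp : 'I_N -> nat;
  wgt : forall k, 'I_m -> 'I_m -> 'I_(ncomp k) -> R;
  mean : forall k, 'I_m -> 'I_m -> 'I_(ncomp k) -> 'cV[R]_(nx + nx);
  cov : forall k, 'I_m -> 'I_m -> 'I_(ncomp k) -> 'M[R]_(nx + nx) }.

Definition mixture_density (G : mixtures) k i j
    (p : euclid R nx * euclid R nx) : R :=
  \sum_(l < ncomp G k) wgt i j l *
    gauss (col_mx (vec p.1) (vec p.2)) (mean i j l) (cov i j l).

(* Equality of the joint-smoothed distribution with the one whose density is the
   mixture; equality of densities is only meant almost everywhere. *)
Definition joint_smoothed_mixture th (G : mixtures) : Prop :=
  [/\ forall k i j (l : 'I_(ncomp G k)), 0 <= wgt i j l,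
      forall k i j (l : 'I_(ncomp G k)), spd (cov i j l) &
      forall k i j A, measurable A ->
        joint_smoothed th k i j A =
        (\int[@pair_leb R nx]_(p in A) (mixture_density G k i j p)%:E)%E].

Section statistics.
Context (G : mixtures).

Definition c_m (z : 'I_m) : R :=
  \sum_(k < N) \sum_(j < m) \sum_(l < ncomp G k) wgt z j l.

Definition trans_weight (zs z : 'I_m) : R :=
  \sum_(k < N) \sum_(l < ncomp G k) wgt z zs l.

Definition mixture_sum (z : 'I_m) a b
    (F : 'I_N -> 'cV[R]_nx -> 'cV[R]_nx -> 'M[R]_(a, b)) : 'M[R]_(a, b) :=
  \sum_(k < N) \sum_(j < m) \sum_(l < ncomp G k)
    wgt z j l *: pair_expect (mean z j l) (cov z j l) (F k).

Definition Sigma z : 'M[R]_(nx + nu) :=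
  mixture_sum z (fun k x x' => xu k x *m (xu k x)^T).

Definition Phi z : 'M[R]_(ny + nx) :=
  mixture_sum z (fun k x x' => yx k x' *m (yx k x')^T).

Definition Psi z : 'M[R]_(ny + nx, nx + nu) :=
  mixture_sum z (fun k x x' => yx k x' *m (xu k x)^T).

Definition Gam_update z : 'M[R]_(ny + nx, nx + nu) :=
  Psi z *m invmx (Sigma z).

Definition Pi_update z (Gm : 'M[R]_(ny + nx, nx + nu)) : 'M[R]_(ny + nx) :=
  (c_m z)^-1 *: (Phi z - Gm *m (Psi z)^T - Psi z *m Gm^T
                 + Gm *m Sigma z *m Gm^T).

End statistics.

Definition is_maximiser (F : set params) (f : params -> \bar R) th : Prop :=
  F th /\ forall th2, F th2 -> (f th2 <= f th)%E.

(* th has the same initial density as th0 if fI holds, and the same Gamma(z),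
   Pi(z) and column z of T as th0 for z in fG, fP and fT respectively. *)
Definition agrees (fI : bool) (fG fP fT : {set 'I_m}) (th0 th : params) : Prop :=
  [/\ fI -> init th = init th0,
      forall z, z \in fG -> Gam th z = Gam th0 z,
      forall z, z \in fP -> Pi th z = Pi th0 z &
      forall z, z \in fT -> col z (Tmx th) = col z (Tmx th0)].

End jump_markov_linear_system.

(* Main.v *)
Require Import Defs.
From HB Require Import structures.
From mathcomp Require Import all_boot all_order all_algebra.
From mathcomp Require Import all_classical all_reals all_analysis.
From mathcomp Require Import measurable_realfun ring lra.

Set Implicit Arguments.
Unset Strict Implicit.
Unset Printing Implicit Defensive.

Import Order.TTheory GRing.Theory Num.Theory.
Import numFieldNormedType.Exports.

Local Open Scope classical_set_scope.
Local Open Scope ring_scope.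

(* The value Q(theta, theta') is an initial term plus a sum over the modes.  The
   integral of ln(joint density) against the posterior splits, path by path, even
   though the initial term may be infinite, because -oo absorbs +oo; grouping the
   paths by (z_k, z_(k+1)) and replacing the posterior of (x_k, x_(k+1)) by the
   Gaussian mixture then turns the remaining terms into the finite statistics
   c_m, Sigma, Phi, Psi.

   Each term is maximised separately: the initial density and the columns of T by
   q ln p <= q ln q + p - q, Gamma by completing the square in
   Phi - Gamma Psi^T - Psi Gamma^T + Gamma Sigma Gamma^T, and Pi by
   ln det W <= tr W - n for a positive definite W. *)

(** * Positive definite matrices *)

Section spd_matrices.
Context (R : realType).

(** Three obstacles shape the proof. The initial term integrates [q ln p], which need not be
    integrable even at its optimum; hence addition and comparison lemmas that ask only measurability
    of the possibly infinite function. The emission terms stay finite because the logarithm of a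
    Gaussian density grows quadratically and Gaussian mixtures have second moments.

    The mixture hypothesis equates measures, and only for the total over all mode paths with given
    [z_k] and [z_(k+1)]. Test functions are therefore transferred through simple functions, and
    integrability along a single path comes from domination by its group.

    The posterior divides by [fine] of the evidence, which would be [0] if the evidence were
    infinite, so finiteness must be proved. It holds because, with [y_k] fixed, the emission density
    integrated over [x_(k+1)] is bounded uniformly in [x_k].

    Cholesky factors, determinants and the Gaussian normalisation all come from Schur
    complements. *)

Definition quad n (P : 'M[R]_n) (v : 'cV[R]_n) : R := (v^T *m P *m v) ord0 ord0.

Lemma quad_congr n p (B : 'M[R]_(p, n)) (P : 'M[R]_p) v :
  quad (B^T *m P *m B) v = quad P (B *m v).
Proof. by rewrite /quad trmx_mul !mulmxA. Qed.

Lemma quad1 n (v : 'cV[R]_n) : quad 1%:M v = \sum_i v i ord0 ^+ 2.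
Proof. by rewrite /quad mulmx1 mxE; apply: eq_bigr => i _; rewrite mxE expr2. Qed.

Lemma quadZ n a (P : 'M[R]_n) v : quad (a *: P) v = a * quad P v.
Proof. by rewrite /quad -scalemxAr -scalemxAl mxE. Qed.

Lemma quad0r n (P : 'M[R]_n) : quad P 0 = 0.
Proof. by rewrite /quad mulmx0 mxE. Qed.

Lemma spd_quad_ge0 n (P : 'M[R]_n) v : spd P -> 0 <= quad P v.
Proof.
move=> [_ P0]; have [->|v0] := eqVneq v 0; first by rewrite quad0r.
exact/ltW/P0.
Qed.

Lemma spd_unit n (P : 'M[R]_n) : spd P -> P \in unitmx.
Proof.
move=> [_ P0]; rewrite unitmxE unitfE; apply/negP => /det0P[v v0 vP].
have := P0 v^T; rewrite trmxK vP mul0mx mxE ltxx => h.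
by have /h : v^T != 0 by rewrite -(inj_eq trmx_inj) trmxK trmx0.
Qed.

Lemma spd_congr n (B P : 'M[R]_n) : B \in unitmx -> spd P -> spd (B^T *m P *m B).
Proof.
move=> uB [sP P0]; split; first by rewrite !trmx_mul trmxK sP mulmxA.
move=> v v0; rewrite -/(quad _ _) quad_congr; apply: P0.
by apply: contraNneq v0 => Bv; rewrite -(mulKmx uB v) Bv mulmx0.
Qed.

Lemma spd_inv n (P : 'M[R]_n) : spd P -> spd (invmx P).
Proof.
move=> sP; have uP := spd_unit sP.
have := spd_congr (B := invmx P) _ sP.
by rewrite unitmx_inv trmx_inv sP.1 mulVmx// mul1mx; exact.
Qed.

Lemma spd1 n : spd (1%:M : 'M[R]_n).
Proof.
split; first exact: trmx1.
move=> v v0; rewrite -/(quad _ _) quad1 lt_neqAle sumr_ge0 ?andbT; last first.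
  by move=> i _; exact: sqr_ge0.
apply: contra_neq v0 => /esym/eqP; rewrite psumr_eq0; last first.
  by move=> i _; exact: sqr_ge0.
move=> /allP v0; apply/matrixP => i j; rewrite ord1 mxE.
by apply/eqP; rewrite -sqrf_eq0; apply: v0; rewrite mem_index_enum.
Qed.

Lemma spdZ n a (P : 'M[R]_n) : 0 < a -> spd P -> spd (a *: P).
Proof.
move=> a0 [sP P0]; split; first by rewrite linearZ/= sP.
by move=> v v0; rewrite -/(quad _ _) quadZ mulr_gt0// P0.
Qed.

(** The Schur complement of the lower right block, with the upper right block written as the
    transpose of the lower left one, as is right for symmetric [P]. If [P] is a precision matrix,
    this is the precision of the marginal of the first [a] coordinates. *)
Definition schur a b (P : 'M[R]_(a + b)) : 'M[R]_a :=
  ulsubmx P - (dlsubmx P)^T *m invmx (drsubmx P) *m dlsubmx P.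

Section schur_complement.
Variables (a b : nat) (P : 'M[R]_(a + b)).
Hypothesis sP : spd P.

Let shear : 'M[R]_(a + b) :=
  block_mx 1%:M 0 (invmx (drsubmx P) *m dlsubmx P) 1%:M.

Lemma spd_dr : spd (drsubmx P).
Proof.
split; first by rewrite trmx_drsub sP.1.
move=> v v0; have := sP.2 (col_mx 0 v).
rewrite -{1}(submxK P) tr_col_mx mul_row_block mul_row_col trmx0 !mul0mx mulmx0.
by rewrite !add0r; apply; rewrite col_mx_eq0 eqxx.
Qed.

(** Symmetric block elimination: [shear] completes the square in the last [b] coordinates and so
    removes the cross terms. Its determinant is 1. *)
Lemma schur_factor : P = shear^T *m block_mx (schur P) 0 0 (drsubmx P) *m shear.
Proof.
have uD := spd_unit spd_dr.
rewrite /shear tr_block_mx !trmx1 trmx0 !mulmx_block !mulmx0 !mul0mx !mulmx1 !mul1mx.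
rewrite !addr0 !add0r trmx_mul trmx_inv spd_dr.1 -!mulmxA mulKVmx//.
rewrite mulVmx// mulmx1 /schur mulmxA addrNK trmx_dlsub sP.1.
by rewrite submxK.
Qed.

Lemma det_schur : \det P = \det (schur P) * \det (drsubmx P).
Proof.
rewrite {1}schur_factor !det_mulmx det_tr.
by rewrite det_lblock !det1 det_ublock !mul1r mulr1.
Qed.

Lemma quad_schur x y :
  quad P (col_mx x y) =
  quad (schur P) x + quad (drsubmx P) (y + invmx (drsubmx P) *m dlsubmx P *m x).
Proof.
rewrite {1}schur_factor quad_congr /shear mul_block_col !mul1mx mul0mx addr0.
rewrite /quad tr_col_mx mul_row_block !mulmx0 addr0 add0r mul_row_col mxE.
by rewrite addrC (addrC y) addrC.
Qed.

Lemma spd_schur : spd (schur P).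
Proof.
split.
  rewrite /schur linearB/= !trmx_mul trmxK trmx_inv spd_dr.1 mulmxA.
  by rewrite trmx_ulsub sP.1.
(* The second block is the one that makes the second square of [quad_schur] vanish. *)
move=> v v0; have := sP.2 (col_mx v (- (invmx (drsubmx P) *m dlsubmx P *m v))).
rewrite -/(quad _ _) quad_schur addNr quad0r addr0; apply.
by rewrite col_mx_eq0 negb_and v0.
Qed.

End schur_complement.

Lemma quad11 (P : 'M[R]_1) v : quad P v = P ord0 ord0 * v ord0 ord0 ^+ 2.
Proof.
by rewrite /quad !mxE big_ord1 !mxE big_ord1 !mxE; ring.
Qed.

Lemma spd11_gt0 (P : 'M[R]_1) : spd P -> 0 < P ord0 ord0.
Proof.
move=> [_ /(_ 1)]; rewrite -/(quad _ _) quad11 mxE eqxx expr1n mulr1; apply.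
exact: oner_neq0.
Qed.

(** One coordinate is peeled off at a time: its Schur complement is a positive scalar [s], and
    induction factors the remaining block. [C] collects the roots of the two diagonal blocks and [U]
    is the shear of [schur_factor]. *)
Lemma cholesky n (P : 'M[R]_n) : spd P -> exists2 B, B \in unitmx & P = B^T *m B.
Proof.
elim: n P => [|n IH] P sP.
  by exists 1%:M; [exact: unitmx1|apply/matrixP => -[]].
have [B uB BP] := IH _ (@spd_dr 1 n P sP).
have s0 := spd11_gt0 (@spd_schur 1 n P sP).
set s := schur _ ord0 ord0 in s0.
pose C : 'M[R]_(1 + n) := block_mx (Num.sqrt s)%:M 0 0 B.
pose U : 'M[R]_(1 + n) :=
  block_mx 1%:M 0 (invmx (@drsubmx _ 1 n 1 n P) *m (@dlsubmx _ 1 n 1 n P)) 1%:M.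
exists (C *m U).
  rewrite unitmx_mul !unitmxE (@det_ublock _ 1 n) (@det_lblock _ 1 n) !det1 mulr1.
  rewrite unitr1 andbT det_scalar1 unitrM -[\det B \is a _]unitmxE uB andbT unitfE.
  by rewrite gt_eqF// sqrtr_gt0.
rewrite {1}(schur_factor (a := 1) (b := n) sP) trmx_mul -!mulmxA; congr (_ *m _).
rewrite mulmxA; congr (_ *m _).
have -> : C^T *m C =
    (block_mx ((Num.sqrt s)%:M *m (Num.sqrt s)%:M) 0 0 (B^T *m B) : 'M[R]_(1 + n)).
  rewrite (@tr_block_mx _ 1 n 1 n) (@mulmx_block _ 1 n 1 n) !trmx0 !mulmx0 !mul0mx !addr0.
  by rewrite add0r tr_scalar_mx.
rewrite -BP -scalar_mxM -expr2 sqr_sqrtr ?ltW//; congr block_mx.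
by rewrite [LHS]mx11_scalar.
Qed.

Lemma spd_det_gt0 n (P : 'M[R]_n) : spd P -> 0 < \det P.
Proof.
move=> /cholesky[B uB ->]; rewrite det_mulmx det_tr -expr2.
by rewrite exprn_even_gt0//= -unitfE -unitmxE.
Qed.

(** With [P = B^T *m B], recover [v] as [invmx B *m (B *m v)]; then [K], the squared Frobenius norm
    of [invmx B], bounds the loss. The [+ 1] keeps the constant positive in dimension 0, where
    [K = 0]. *)
Lemma spd_coercive n (P : 'M[R]_n) : spd P ->
  exists2 c : R, 0 < c & forall v : 'cV_n, c * quad 1%:M v <= quad P v.
Proof.
move=> /cholesky[B uB ->].
pose K := \sum_i \sum_j invmx B i j ^+ 2.
have K0 : 0 <= K by rewrite !sumr_ge0// => i _; rewrite sumr_ge0// => j _; exact: sqr_ge0.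
have K1 : 0 < K + 1 by rewrite ltr_wpDl.
exists (K + 1)^-1 => [|v]; first by rewrite invr_gt0.
rewrite -[B^T]mulmx1 quad_congr mulrC ler_pdivrMr// mulrC.
have E : v = invmx B *m (B *m v) by rewrite mulKmx.
set w := B *m v in E *.
have w0 : 0 <= quad 1%:M w by apply: spd_quad_ge0; exact: spd1.
apply: (@le_trans _ _ (K * quad 1%:M w)); last by rewrite ler_wpM2r// lerDl.
rewrite {1}quad1 /K mulr_suml ler_sum// => i _; rewrite E mxE.
(* Cauchy-Schwarz, from the nonnegativity of [\sum_j (t a_j - s w_j)^2] *)
set a := fun j => invmx B i j.
rewrite -/(a) quad1; set x := fun j => w j ord0.
rewrite (_ : \sum_j _ = \sum_j a j * x j)//.
set A := \sum_j _ ^+ 2; set X := \sum_j x j ^+ 2; set S := \sum_j _.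
have X0 : 0 <= X by rewrite sumr_ge0// => j _; exact: sqr_ge0.
have H : 0 <= \sum_j (X * a j - S * x j) ^+ 2.
  by rewrite sumr_ge0// => j _; exact: sqr_ge0.
have {}H : 0 <= X * (A * X - S ^+ 2).
  suff -> : X * (A * X - S ^+ 2) = \sum_j (X * a j - S * x j) ^+ 2 by [].
  transitivity (\sum_j (X ^+ 2 * a j ^+ 2 + (S ^+ 2 * x j ^+ 2 -
    (2 * X * S) * (a j * x j)))); last first.
    by apply: eq_bigr => j _; ring.
  rewrite big_split/= sumrB -!mulr_sumr.
  rewrite -/X -/S (_ : \sum_j a j ^+ 2 = A)//; ring.
have [X00|XN] := eqVneq X 0; last first.
  by rewrite -subr_ge0 -(pmulr_rge0 _ (_ : 0 < X))// lt_neqAle eq_sym XN.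
have x0 j : x j = 0.
  apply/eqP; rewrite -sqrf_eq0; move/eqP: X00; rewrite psumr_eq0; last first.
    by move=> k _; exact: sqr_ge0.
  by move/allP => /(_ j); apply; rewrite mem_index_enum.
by rewrite X00 mulr0 (_ : S = 0) ?expr0n// /S big1// => j _; rewrite x0 mulr0.
Qed.

(** The determinant is the product of a scalar Schur complement [s] and a smaller determinant. Here
    [ln s <= s - 1], and [s] is at most the corner entry, from which it subtracts a value of a
    positive definite form. *)
Lemma ln_det_le_trace n (P : 'M[R]_n) : spd P -> ln (\det P) <= \tr P - n%:R.
Proof.
elim: n P => [|n IH] P sP.
  by rewrite det_mx00 ln1 /mxtrace big_ord0 subrr.
have sS := @spd_schur 1 n P sP; have sD := @spd_dr 1 n P sP.
rewrite (@det_schur 1 n P sP) lnM ?posrE ?spd_det_gt0//.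
have -> : \tr P = \tr (@ulsubmx _ 1 n 1 n P) + \tr (@drsubmx _ 1 n 1 n P).
  by rewrite -{1}(@submxK _ 1 n 1 n P) (@mxtrace_block _ 1 n).
rewrite -natr1 opprD addrACA [leRHS]addrC.
rewrite [leLHS]addrC -[leRHS]addrC addrA.
have := IH _ sD.
have : ln (\det (@schur 1 n P)) <= \tr (@ulsubmx _ 1 n 1 n P) - 1.
  rewrite det_mx11 /mxtrace big_ord1.
  have s0 := spd11_gt0 sS.
  have := @le_ln1Dx R (@schur 1 n P ord0 ord0 - 1).
  rewrite -subr_gt0 opprK subrK (addrC 1) subrK => /(_ s0); move/le_trans; apply.
  rewrite lerD2r /schur [_ ord0 ord0]mxE gerDl mxE oppr_le0.
  have := spd_quad_ge0 (@dlsubmx _ 1 n 1 n P) (spd_inv sD).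
  by rewrite /quad.
lra.
Qed.

End spd_matrices.

(** * Gaussian integrals *)

Section measurable_matrices.
Context d (T : measurableType d) (R : realType).

Definition measurable_mx n p (F : T -> 'M[R]_(n, p)) : Prop :=
  forall i j, measurable_fun setT (fun x => F x i j).

Lemma measurable_mx_cst n p (A : 'M[R]_(n, p)) : measurable_mx (fun=> A).
Proof. by move=> i j; exact: measurable_cst. Qed.

Lemma measurable_mxB n p (F H : T -> 'M[R]_(n, p)) :
  measurable_mx F -> measurable_mx H -> measurable_mx (fun x => F x - H x).
Proof.
by move=> mF mH i j; under eq_fun do rewrite !mxE; exact: measurable_funB.
Qed.

Lemma measurable_mxM n p q (F : T -> 'M[R]_(n, p)) (H : T -> 'M[R]_(p, q)) :
  measurable_mx F -> measurable_mx H -> measurable_mx (fun x => F x *m H x).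
Proof.
move=> mF mH i j; under eq_fun do rewrite mxE.
by apply: measurable_sum => k; exact: measurable_funM.
Qed.

Lemma measurable_mx_tr n p (F : T -> 'M[R]_(n, p)) :
  measurable_mx F -> measurable_mx (fun x => (F x)^T).
Proof. by move=> mF i j; under eq_fun do rewrite mxE; exact: mF. Qed.

Lemma measurable_mx_col n p q (F : T -> 'M[R]_(n, q)) (H : T -> 'M[R]_(p, q)) :
  measurable_mx F -> measurable_mx H -> measurable_mx (fun x => col_mx (F x) (H x)).
Proof.
move=> mF mH i j; under eq_fun do rewrite mxE.
by case: splitP => k _; [exact: mF|exact: mH].
Qed.

Lemma measurable_mx_vec n (f : T -> euclid R n) :
  measurable_fun setT f -> measurable_mx (fun x => vec (f x)).
Proof.
move=> mf i j; under eq_fun do rewrite mxE.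
exact: (measurableT_comp (measurable_tnth i) mf).
Qed.

Lemma measurable_quad n (P : 'M[R]_n) (F : T -> 'cV[R]_n) :
  measurable_mx F -> measurable_fun setT (fun x => quad P (F x)).
Proof.
move=> mF; apply: (measurable_mxM _ mF).
by apply: measurable_mxM (measurable_mx_cst P); exact: measurable_mx_tr.
Qed.

Lemma measurable_gauss n (P : 'M[R]_n) (F H : T -> 'cV[R]_n) :
  measurable_mx F -> measurable_mx H ->
  measurable_fun setT (fun x => gauss (F x) (H x) P).
Proof.
move=> mF mH; apply: measurable_funM => //; apply: measurableT_comp => //.
apply: measurable_funN; apply: measurable_funM => //.
by apply: measurable_quad; exact: measurable_mxB.
Qed.

End measurable_matrices.

(** The power measure is the image of a product measure under [tcons], so this is Tonelli's theorem
    after pulling back. *)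
Lemma ge0_integral_measure_powerS d (T : measurableType d) (R : realType)
    (mu : {sigma_finite_measure set T -> \bar R}) n (f : n.+1.-tuple T -> \bar R) :
  measurable_fun [set: n.+1.-tuple T] f -> (forall t, 0 <= f t)%E ->
  (\int[measure_power mu n.+1]_t f t =
   \int[mu]_a \int[measure_power mu n]_t f (tcons (a, t)))%E.
Proof.
move=> mf f0; rewrite ge0_integral_pushforward//; last exact: measurable_tcons.
rewrite preimage_setT fubini_tonelli1//; last by move=> p; exact: f0.
by apply: measurableT_comp => //; exact: measurable_tcons.
Qed.

Section gaussian_integrals.
Context (R : realType).
Implicit Types n : nat.

Lemma measurable_expq d (T : measurableType d) n (P : 'M[R]_n) (F : T -> 'cV[R]_n) :
  measurable_mx F -> measurable_fun setT (fun x => expR (- (quad P (F x) / 2))).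
Proof.
move=> mF; apply: measurableT_comp => //; apply: measurable_funN.
by apply: measurable_funM => //; exact: measurable_quad.
Qed.

(** The normalisation of the one-dimensional normal density with standard deviation [si], solved for
    the integral of its exponential factor. *)
Lemma integral_exp_sqr (s c : R) : 0 < s ->
  (\int[lebesgue_measure]_x (expR (- (s * (x - c) ^+ 2 / 2)))%:E =
   (Num.sqrt (2 * pi / s))%:E)%E.
Proof.
move=> s0; pose si := (Num.sqrt s)^-1.
have si0 : si != 0 by rewrite invr_eq0 sqrtr_eq0 -ltNge.
have si2 : si ^+ 2 = s^-1 by rewrite exprVn sqr_sqrtr// ltW.
have K0 := normal_peak_gt0 si0.
have KE : normal_peak si = (Num.sqrt (2 * pi / s))^-1.
  by rewrite /normal_peak si2; congr (Num.sqrt _)^-1; rewrite -mulr_natl; ring.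
have := integral_normal_pdf c si; rewrite normal_pdfE//.
under eq_integral do rewrite EFinM.
rewrite ge0_integralZl_EFin//; last 3 first.
- by move=> x _; rewrite lee_fin normal_fun_ge0.
- by apply/measurable_EFinP; exact: measurable_normal_fun.
- exact: ltW.
move=> /(congr1 (fun x => (Num.sqrt (2 * pi / s))%:E * x)%E).
rewrite muleA -EFinM mule1 KE divff ?mul1e; last first.
  by rewrite -invr_eq0 -KE gt_eqF.
move=> <-; apply: eq_integral => x _; congr (expR _)%:E.
by rewrite si2 -mulr_natl; field; rewrite gt_eqF.
Qed.

(** Here [P] is a precision matrix. The centre is kept general in the induction because the inner
    integral is centred at a point that moves with the first coordinate; its value does not depend
    on that centre. *)
Lemma integral_exp_quad n (P : 'M[R]_n) (c : 'cV[R]_n) : spd P ->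
  (\int[leb R n]_x (expR (- (quad P (vec x - c) / 2)))%:E =
   (Num.sqrt ((2 * pi) ^+ n / \det P))%:E)%E.
Proof.
have mE k (Q : 'M[R]_k) e : measurable_fun [set: euclid R k] (fun x : euclid R k => (expR (- (quad Q (vec x - e) / 2)))%:E).
  apply/measurable_EFinP; apply: measurable_expq; apply: measurable_mxB.
    by apply: measurable_mx_vec.
  exact: measurable_mx_cst.
elim: n P c => [|n IH] P c sP.
  rewrite integral_dirac//; last exact: mE.
  rewrite diracE in_setT mul1e det_mx00 divr1 sqrtr1.
  by rewrite (_ : _ - c = 0) ?quad0r ?mul0r ?oppr0 ?expR0//; apply/matrixP => -[].
have sS := @spd_schur _ 1 n P sP; have sD := @spd_dr _ 1 n P sP.
have s0 := spd11_gt0 sS; set s := schur _ ord0 ord0 in s0.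
rewrite ge0_integral_measure_powerS//.
pose c0 := @usubmx _ 1 n 1 c ord0 ord0.
(* The conditional mean of the other coordinates when the first one equals [a]. *)
pose e a : 'cV[R]_n := @dsubmx _ 1 n 1 c - invmx (@drsubmx _ 1 n 1 n P) *m
  (@dlsubmx _ 1 n 1 n P) *m (const_mx (a - c0) : 'cV[R]_1).
have E a t : expR (- (quad P (vec (tcons (a, t)) - c) / 2)) =
    expR (- (s * (a - c0) ^+ 2 / 2)) *
    expR (- (quad (@drsubmx _ 1 n 1 n P) (vec t - e a) / 2)).
  rewrite -expRD -opprD -mulrDl; congr (expR (- (_ / 2))).
  have -> : vec (tcons (a, t)) - c =
      (col_mx (const_mx (a - c0)) (vec t - @dsubmx _ 1 n 1 c) : 'cV[R]_(1 + n)).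
    apply/matrixP => i j; rewrite ord1.
    case: (unliftP ord0 i) => [k ->|->].
      have -> : lift ord0 k = rshift 1 k by exact/val_inj.
      rewrite (@col_mxEd _ 1 n) !mxE/=; congr (_ - _).
      by rewrite (_ : rshift 1 k = lift ord0 k) ?tnthS//; exact/val_inj.
    have -> : ord0 = lshift n ord0 :> 'I_(1 + n) by exact/val_inj.
    rewrite (@col_mxEu _ 1 n) /c0 !mxE; congr (_ - _).
  rewrite (@quad_schur _ 1 n P sP) quad11 -/s; congr (_ + _); first by rewrite mxE.
  by rewrite /e opprB addrA addrAC.
transitivity (\int[lebesgue_measure]_a ((expR (- (s * (a - c0) ^+ 2 / 2)))%:E *
    (Num.sqrt ((2 * pi) ^+ n / \det (@drsubmx _ 1 n 1 n P)))%:E))%E.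
  apply: eq_integral => a _; under eq_integral do rewrite E EFinM.
  rewrite ge0_integralZl_EFin ?IH// ?expR_ge0//.
  exact: mE.
rewrite ge0_integralZr//; last first.
  apply/measurable_EFinP; apply: measurableT_comp => //; apply: measurable_funN.
  apply: measurable_funM => //; apply: measurable_funM => //.
  by apply: measurable_funX; exact: measurable_funB.
rewrite integral_exp_sqr// -EFinM -sqrtrM; last first.
  by rewrite mulr_ge0 ?invr_ge0 ?ltW// mulr_gt0 ?pi_gt0.
rewrite (@det_schur _ 1 n P sP) det_mx11 -/s exprS invfM; congr (Num.sqrt _)%:E.
by rewrite mulrACA.
Qed.

(** [pair_leb] is a product of two copies of [leb n] and not [leb (n + n)]; the same elimination is
    done once, with blocks of size [n]. *)
Lemma integral_pair_exp_quad n (P : 'M[R]_(n + n)) (c : 'cV[R]_(n + n)) : spd P ->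
  (\int[@pair_leb R n]_p (expR (- (quad P (col_mx (vec p.1) (vec p.2) - c) / 2)))%:E
   = (Num.sqrt ((2 * pi) ^+ (n + n) / \det P))%:E)%E.
Proof.
move=> sP; have sS := spd_schur sP; have sD := spd_dr sP.
pose e (x : 'cV[R]_n) : 'cV[R]_n :=
  dsubmx c - invmx (drsubmx P) *m dlsubmx P *m (x - usubmx c).
have E x y : expR (- (quad P (col_mx x y - c) / 2)) =
    expR (- (quad (schur P) (x - usubmx c) / 2)) *
    expR (- (quad (drsubmx P) (y - e x) / 2)).
  rewrite -expRD -opprD -mulrDl; congr (expR (- (_ / 2))).
  rewrite -{1}[c]vsubmxK opp_col_mx add_col_mx (quad_schur sP).
  by congr (_ + quad _ _); rewrite /e opprB addrA addrAC.
have mv1 : measurable_mx (fun p : euclid R n * euclid R n => vec p.1).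
  by apply: measurable_mx_vec.
have mv2 : measurable_mx (fun p : euclid R n * euclid R n => vec p.2).
  by apply: measurable_mx_vec.
have mE (Q : 'M[R]_n) e' : measurable_fun [set: euclid R n] (fun x : euclid R n => (expR (- (quad Q (vec x - e') / 2)))%:E).
  apply/measurable_EFinP; apply: measurable_expq; apply: measurable_mxB.
    by apply: measurable_mx_vec.
  exact: measurable_mx_cst.
rewrite fubini_tonelli1/=; last 2 first.
- apply/measurable_EFinP; apply: measurable_expq; apply: measurable_mxB.
    exact: measurable_mx_col.
  exact: measurable_mx_cst.
- by move=> p; rewrite lee_fin expR_ge0.
transitivity (\int[leb R n]_x ((expR (- (quad (schur P) (vec x - usubmx c) / 2)))%:E *
    (Num.sqrt ((2 * pi) ^+ n / \det (drsubmx P)))%:E))%E.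
  apply: eq_integral => x _; rewrite /fubini_F/=.
  under eq_integral do rewrite E EFinM.
  rewrite ge0_integralZl_EFin ?integral_exp_quad// ?expR_ge0//.
rewrite ge0_integralZr//.
rewrite integral_exp_quad// -EFinM -sqrtrM; last first.
  by rewrite divr_ge0// ?exprn_ge0// ?mulr_ge0 ?pi_ge0// ltW// spd_det_gt0.
by rewrite (det_schur sP) exprD invfM mulrACA.
Qed.

Lemma gauss_peak_gt0 n (P : 'M[R]_n) : spd P -> 0 < (Num.sqrt ((2 * pi) ^+ n * \det P))^-1.
Proof.
move=> sP; rewrite invr_gt0 sqrtr_gt0 mulr_gt0 ?spd_det_gt0// exprn_gt0//.
by rewrite mulr_gt0 ?pi_gt0.
Qed.

Lemma gauss_gt0 n (x c : 'cV[R]_n) P : spd P -> 0 < gauss x c P.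
Proof. by move=> sP; rewrite /gauss mulr_gt0 ?expR_gt0// gauss_peak_gt0. Qed.

Lemma integral_gauss_pair n (c : 'cV[R]_(n + n)) P : spd P ->
  (\int[@pair_leb R n]_p (gauss (col_mx (vec p.1) (vec p.2)) c P)%:E = 1)%E.
Proof.
move=> sP; have k0 := ltW (gauss_peak_gt0 sP).
have mE : measurable_fun [set: euclid R n * euclid R n] (fun p =>
    (expR (- (quad (invmx P) (col_mx (vec p.1) (vec p.2) - c) / 2)))%:E).
  apply/measurable_EFinP; apply: measurable_expq; apply: measurable_mxB.
    by apply: measurable_mx_col; apply: measurable_mx_vec.
  exact: measurable_mx_cst.
under eq_integral do rewrite EFinM.
rewrite ge0_integralZl_EFin//.
rewrite (integral_pair_exp_quad c (spd_inv sP)) det_inv invrK -EFinM mulVf//.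
by rewrite -invr_eq0 gt_eqF// gauss_peak_gt0.
Qed.

(* With [q] the quadratic form of [P^-1] at [x - c], one has
   [1 + q <= 4 exp(q/4)], so that a quadratically bounded function times the
   density is at most a multiple of [exp(-q/4)]. *)
Lemma integrable_quadratic_gauss n (c : 'cV[R]_(n + n)) P
    (F : euclid R n * euclid R n -> R) (C : R) :
  spd P -> measurable_fun setT F ->
  (forall p, `|F p| <= C * (1 + quad 1%:M (col_mx (vec p.1) (vec p.2)))) ->
  (@pair_leb R n).-integrable setT
    (fun p => (F p * gauss (col_mx (vec p.1) (vec p.2)) c P)%:E).
Proof.
move=> sP mF FC; have sI := spd_inv sP.
have mV : measurable_mx (fun p : euclid R n * euclid R n =>
    col_mx (vec p.1) (vec p.2)).
  by apply: measurable_mx_col; apply: measurable_mx_vec.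
have mG : measurable_fun [set: euclid R n * euclid R n]
    (fun p : euclid R n * euclid R n =>
    gauss (col_mx (vec p.1) (vec p.2)) c P).
  by apply: measurable_gauss => //; exact: measurable_mx_cst.
have mFG := measurable_funM mF mG.
apply/integrableP; split; first exact/measurable_EFinP.
have [a a0 aP] := spd_coercive sI.
pose k := (Num.sqrt ((2 * pi) ^+ (n + n) * \det P))^-1.
have k0 : 0 < k by exact: gauss_peak_gt0.
(* From [|v|^2 <= 2 |c|^2 + 2 |v - c|^2] and [|v - c|^2 <= q / a]; the coefficient 8 is 4 times 2,
   as [q] appears below as [q / 4]. In [H] the precision is halved since
   [exp(-q/2) exp(q/4) = exp(-q/4)]. *)
pose D := 1 + 2 * quad 1%:M c + 8 / a.
pose H (p : euclid R n * euclid R n) : R := expR (- (quad (2^-1 *: invmx P)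
  (col_mx (vec p.1) (vec p.2) - c) / 2)).
have s2 : spd (2^-1 *: invmx P) by apply: spdZ => //; rewrite invr_gt0.
have q0 v : 0 <= quad 1%:M v :> R by apply: spd_quad_ge0; exact: spd1.
have H0 (v : 'cV[R]_(n + n)) : 1 + quad 1%:M v <=
    D * expR (quad (invmx P) (v - c) / 4).
  set q := quad (invmx P) (v - c).
  have e1 : 1 + q / 4 <= expR (q / 4) by exact: expR_ge1Dx.
  have qv : quad 1%:M v <= 2 * quad 1%:M c + 2 * quad 1%:M (v - c).
    rewrite !quad1 !mulr_sumr -big_split/=; apply: ler_sum => i _.
    rewrite !mxE -subr_ge0; set x := v i _; set y := c i _.
    suff -> : 2 * y ^+ 2 + 2 * (x - y) ^+ 2 - x ^+ 2 = (x - 2 * y) ^+ 2.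
      exact: sqr_ge0.
    ring.
  have q00 : 0 <= q by exact: spd_quad_ge0.
  have qc : quad 1%:M (v - c) <= a^-1 * q.
    by rewrite ler_pdivlMl//; exact: aP.
  apply: (@le_trans _ _ (D * (1 + q / 4))); last first.
    by rewrite ler_wpM2l// /D !addr_ge0// ?mulr_ge0// invr_ge0 ltW.
  have ai0 : 0 <= a^-1 by rewrite invr_ge0 ltW.
  (* Stated for abstract reals so that, once the product is expanded, [w * r] and [b * r] are atoms
     of a linear problem. *)
  have key (u w z b r : R) : 0 <= b -> 0 <= r -> 0 <= w * r -> 0 <= b * r ->
      u <= 2 * w + 2 * z -> z <= b * r -> 1 + u <= (1 + 2 * w + 8 * b) * (1 + r / 4).
    have -> : (1 + 2 * w + 8 * b) * (1 + r / 4) =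
      1 + 2 * w + 2 * (b * r) + 8 * b + r / 4 + w * r / 2 by field.
    lra.
  by apply: key qv qc => //; exact: mulr_ge0.
have C0 : 0 <= C.
  have := le_trans (normr_ge0 _) (FC ([tuple 0 | _ < n], [tuple 0 | _ < n])).
  by rewrite pmulr_lge0// ltr_pwDl.
apply: (@le_lt_trans _ _ (\int[@pair_leb R n]_p ((C * D * k) * H p)%:E)%E).
  apply: ge0_le_integral => //.
  - by apply: measurableT_comp => //; exact/measurable_EFinP.
  - apply/measurable_EFinP; apply: measurable_funM => //; apply: measurable_expq.
    by apply: measurable_mxB => //; exact: measurable_mx_cst.
  - move=> p _; rewrite /= lee_fin normrM.
    rewrite (ger0_norm (ltW (gauss_gt0 _ _ sP))).
    apply: (le_trans (ler_wpM2r (ltW (gauss_gt0 _ _ sP)) (FC p))).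
    set v := col_mx _ _.
    apply: (le_trans (ler_wpM2r (ltW (gauss_gt0 _ _ sP)) (ler_wpM2l C0 (H0 v)))).
    rewrite /gauss -/k /H -/v quadZ -/(quad _ _) le_eqVlt; apply/orP; left; apply/eqP.
    rewrite -!mulrA; congr (_ * (_ * _)); rewrite mulrCA; congr (_ * _).
    rewrite -expRD; congr expR; by field.
under eq_integral do rewrite EFinM.
rewrite ge0_integralZl_EFin//.
- by rewrite /H (integral_pair_exp_quad _ s2) -EFinM ltry.
- by move=> x _; rewrite lee_fin expR_ge0.
- apply/measurable_EFinP; apply: measurable_expq.
  by apply: measurable_mxB => //; exact: measurable_mx_cst.
- rewrite !mulr_ge0//; last exact: ltW.
  by rewrite /D !addr_ge0// ?mulr_ge0// invr_ge0 ltW.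
Qed.

(** By coercivity the exponent is at most [- a / 2] times a squared distance, and dropping the
    contribution of the observed block [y] leaves a Gaussian in [x] alone. The mean only moves its
    centre, so the bound is uniform in [c]. *)
Lemma integral_gauss_tail_le n p (y : 'cV[R]_p) (P : 'M[R]_(p + n)) : spd P ->
  exists2 C : R, 0 <= C &
    forall c, (\int[leb R n]_x (gauss (col_mx y (vec x)) c P)%:E <= C%:E)%E.
Proof.
move=> sP; have [a a0 aP] := spd_coercive (spd_inv sP).
set k := (Num.sqrt ((2 * pi) ^+ (p + n) * \det P))^-1.
have k0 : 0 < k by exact: gauss_peak_gt0.
pose C := k * Num.sqrt ((2 * pi) ^+ n / \det (a *: 1%:M : 'M[R]_n)).
exists C => [|c]; first by rewrite mulr_ge0 ?sqrtr_ge0// ltW.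
have mV : measurable_mx (fun x : euclid R n => col_mx y (vec x)).
  apply: measurable_mx_col; first exact: measurable_mx_cst.
  by apply: measurable_mx_vec.
have mH : measurable_fun [set: euclid R n] (fun x : euclid R n =>
    expR (- (quad (a *: 1%:M) (vec x - dsubmx c) / 2))).
  apply: measurable_expq; apply: measurable_mxB; last exact: measurable_mx_cst.
  by apply: measurable_mx_vec.
have HE : (\int[leb R n]_x
    (k * expR (- (quad (a *: 1%:M) (vec x - dsubmx c) / 2)))%:E = C%:E)%E.
  under eq_integral do rewrite EFinM.
  rewrite ge0_integralZl_EFin ?integral_exp_quad//.
  - by apply: spdZ => //; exact: spd1.
  - exact/measurable_EFinP.
  - exact: ltW.
rewrite -HE; apply: ge0_le_integral => //.
- by move=> x _; rewrite lee_fin ltW// gauss_gt0.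
- apply/measurable_EFinP; apply: measurable_gauss => //; exact: measurable_mx_cst.
- by apply/measurable_EFinP; exact: measurable_funM.
- move=> x _; rewrite lee_fin /gauss -/k -/(quad _ _) ler_wpM2l ?(ltW k0)// ler_expR.
  rewrite lerN2 ler_wpM2r ?invr_ge0// quadZ; apply: (le_trans _ (aP _)).
  rewrite ler_wpM2l ?(ltW a0)// -{2}[c]vsubmxK opp_col_mx add_col_mx !quad1.
  rewrite big_split_ord/= ler_wpDl//; first by apply: sumr_ge0 => i _; exact: sqr_ge0.
  by apply: ler_sum => i _; rewrite col_mxEd.
Qed.

End gaussian_integrals.

(** * Integrals of extended real functions *)

Section extended_integrals.
Context d (T : measurableType d) (R : realType).
Variable mu : {measure set T -> \bar R}.
Local Open Scope ereal_scope.
Implicit Types f g : T -> \bar R.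

(** Positive parts grow and negative parts shrink, and the difference of extended reals is monotone
    even with [+oo - +oo = -oo]; integrability is not assumed. *)
Lemma le_integral_measurable f g :
  measurable_fun setT f -> measurable_fun setT g -> (forall x, f x <= g x) ->
  \int[mu]_x f x <= \int[mu]_x g x.
Proof.
move=> mf mg fg; rewrite [leLHS]integralE [leRHS]integralE; apply: leeB.
- apply: ge0_le_integral => //; try exact: measurable_funepos.
  by move=> x _; apply: (@funepos_le _ _ setT) => //; rewrite inE.
- apply: ge0_le_integral => //; try exact: measurable_funeneg.
  by move=> x _; apply: (@funeneg_le _ _ setT) => //; rewrite inE.
Qed.

(* When the negative part of [f] has infinite integral, both sides are [-oo],
   whatever the positive part. *)
Lemma integralD_integrable f (g : T -> R) :
  measurable_fun setT f -> mu.-integrable setT (EFin \o g) ->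
  \int[mu]_x (f x + (g x)%:E) = \int[mu]_x f x + \int[mu]_x (g x)%:E.
Proof.
move=> mf ig; have mg : measurable_fun setT (EFin \o g) by exact: measurable_int ig.
have mfg : measurable_fun setT (fun x => f x + (g x)%:E) by exact: emeasurable_funD.
have gfin : \int[mu]_x (g x)%:E \is a fin_num by exact: integrable_fin_num ig.
have nfin : \int[mu]_x `|(g x)%:E| < +oo by case/integrableP : ig.
have n0 : 0 <= \int[mu]_x `|(g x)%:E| by exact: integral_ge0.
have mng : measurable_fun setT (fun x => `|(g x)%:E|) by exact: measurableT_comp.
set fg := (X in measurable_fun _ X) in mfg.
have mp := measurable_funepos mf; have mn := measurable_funeneg mf.
have mP := measurable_funepos mfg; have mN := measurable_funeneg mfg.
have le1 (a b : T -> \bar R) : measurable_fun setT a -> measurable_fun setT b ->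
    (forall x, 0 <= a x) -> (forall x, 0 <= b x) ->
    (forall x, a x <= b x + `|(g x)%:E|) ->
    \int[mu]_x a x <= \int[mu]_x b x + \int[mu]_x `|(g x)%:E|.
  move=> ma mb a0 b0 ab; rewrite -ge0_integralD//.
  by apply: ge0_le_integral => //; exact: emeasurable_funD.
have ng x : `|(g x)%:E| = `|g x|%:E by [].
have hN x : f^\- x <= fg^\- x + `|(g x)%:E|.
  rewrite !funenegE /fg ng; case: (f x) => [r| |]; rewrite ?leey//=; last first.
    by rewrite leeDl// lee_fin.
  rewrite -!EFin_max -EFinD lee_fin.
  have := ler_norm (g x); have := ler_norm (- g x)%R; rewrite normrN => h1 h2.
  by rewrite !maxEle; do 2 case: ifPn => [|/negP]; lra.
have hP x : f^\+ x <= fg^\+ x + `|(g x)%:E|.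
  rewrite !funeposE /fg ng; case: (f x) => [r| |]//=; last by rewrite leeDl// lee_fin.
  rewrite -EFinD -!EFin_max -EFinD lee_fin.
  have := ler_norm (g x); have := ler_norm (- g x)%R; rewrite normrN => h1 h2.
  by rewrite !maxEle; do 2 case: ifPn => [|/negP]; lra.
have hN' x : fg^\- x <= f^\- x + `|(g x)%:E|.
  rewrite !funenegE /fg ng; case: (f x) => [r| |]//=; try by rewrite leeDl// lee_fin.
  rewrite -!EFin_max -EFinD lee_fin.
  have := ler_norm (g x); have := ler_norm (- g x)%R; rewrite normrN => h1 h2.
  by rewrite !maxEle; do 2 case: ifPn => [|/negP]; lra.
have IN := le1 _ _ mn mN (funeneg_ge0 _) (funeneg_ge0 _) hN.
have IP := le1 _ _ mp mP (funepos_ge0 _) (funepos_ge0 _) hP.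
have IN' := le1 _ _ mN mn (funeneg_ge0 _) (funeneg_ge0 _) hN'.
have [Nf|Nf] := eqVneq (\int[mu]_x f^\- x) +oo.
  have Nfg : \int[mu]_x fg^\- x = +oo.
    apply/eqP; rewrite -leye_eq; move: IN; rewrite Nf leye_eq => /eqP.
    by case: (\int[mu]_x fg^\- x) => //= r; case: (\int[mu]_x _) nfin.
  by rewrite -[LHS]/(\int[mu]_x fg x) (integralE _ _ fg) (integralE _ _ f) Nf Nfg !addeNy.
have Nf' : \int[mu]_x f^\- x < +oo by rewrite ltey.
have [Pf|Pf] := eqVneq (\int[mu]_x f^\+ x) +oo.
  have Pfg : \int[mu]_x fg^\+ x = +oo.
    apply/eqP; rewrite -leye_eq; move: IP; rewrite Pf leye_eq => /eqP.
    by case: (\int[mu]_x fg^\+ x) => //= r; case: (\int[mu]_x _) nfin.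
  have Nfg : \int[mu]_x fg^\- x < +oo.
    by apply: le_lt_trans IN' _; rewrite lte_add_pinfty.
  rewrite -[LHS]/(\int[mu]_x fg x) (integralE _ _ fg) (integralE _ _ f) Pf Pfg.
  rewrite addye; last by rewrite eqe_oppLR /= lt_eqF.
  rewrite addye; last by rewrite eqe_oppLR /= lt_eqF.
  by rewrite addye//; case: (\int[mu]_x (g x)%:E) gfin.
rewrite integralD//; apply/integrableP; split => //.
rewrite -[X in integral _ _ X]/(abse \o f) fune_abse.
by rewrite ge0_integralD// lte_add_pinfty// ltey.
Qed.

Lemma ge0_funeposMr f g : (forall x, 0 <= g x) ->
  (fun x => f x * g x)^\+ = (fun x => f^\+ x * g x).
Proof.
move=> g0; apply/funext => x; rewrite !funeposE; have gx := g0 x.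
have [f0|f0] := leP 0 (f x); first by rewrite max_l// mule_ge0.
by rewrite max_r ?mul0e// mule_le0_ge0// ltW.
Qed.

Lemma ge0_funenegMr f g : (forall x, 0 <= g x) ->
  (fun x => f x * g x)^\- = (fun x => f^\- x * g x).
Proof.
move=> g0; rewrite -funeposN.
have -> : \- (fun x => f x * g x) = (fun x => (\- f) x * g x).
  by apply/funext => x; rewrite /= mulNe.
by rewrite ge0_funeposMr// funeposN.
Qed.

Lemma integralM_funeposneg f g : (forall x, 0 <= g x) ->
  \int[mu]_x (f x * g x) = \int[mu]_x (f^\+ x * g x) - \int[mu]_x (f^\- x * g x).
Proof. by move=> g0; rewrite integralE ge0_funeposMr// ge0_funenegMr. Qed.

(** Infinite terms are allowed: sums of non-negative terms are never [-oo], so the opposite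
    distributes over them. *)
Lemma sume_ge0B (I : Type) (s : seq I) (P : pred I) (a b : I -> \bar R) :
  (forall i, 0 <= a i) -> (forall i, 0 <= b i) ->
  \sum_(i <- s | P i) (a i - b i) =
  \sum_(i <- s | P i) a i - \sum_(i <- s | P i) b i.
Proof.
move=> a0 b0; elim: s => [|i s IH]; first by rewrite !big_nil sube0.
rewrite !big_cons; case: ifP => // _; rewrite IH.
have A : 0 <= \sum_(j <- s | P j) a j by exact: sume_ge0.
have B : 0 <= \sum_(j <- s | P j) b j by exact: sume_ge0.
by rewrite oppeD ?ge0_adde_def ?inE// addeACA.
Qed.

(** The non-negative weights leave the sign of [f] alone, so the exchange holds separately for the
    two parts of [f], even when both have infinite integrals. *)
Lemma integral_sum_weights (I : Type) (s : seq I) (P : pred I) f (g : I -> T -> \bar R) :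
  measurable_fun setT f -> (forall i, measurable_fun setT (g i)) ->
  (forall i x, 0 <= g i x) ->
  \sum_(i <- s | P i) \int[mu]_x (f x * g i x) =
  \int[mu]_x (f x * \sum_(i <- s | P i) g i x).
Proof.
move=> mf mg g0.
have H (h : T -> \bar R) : measurable_fun setT h -> (forall x, 0 <= h x) ->
    \sum_(i <- s | P i) \int[mu]_x (h x * g i x) =
    \int[mu]_x (h x * \sum_(i <- s | P i) g i x).
  move=> mh h0; under [RHS]eq_integral do rewrite ge0_sume_distrr//.
  rewrite -big_filter; under [RHS]eq_integral do rewrite -big_filter.
  rewrite ge0_integral_sum// => [i|i x _]; last exact: mule_ge0.
  exact: emeasurable_funM.
rewrite integralM_funeposneg; last by move=> x; exact: sume_ge0.
rewrite -!H//; try by [exact: measurable_funepos|exact: measurable_funeneg].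
rewrite -sume_ge0B; last 2 first.
- by move=> i; apply: integral_ge0 => x _; exact: mule_ge0.
- by move=> i; apply: integral_ge0 => x _; exact: mule_ge0.
by apply: eq_bigr => i _; exact: integralM_funeposneg.
Qed.

Lemma measurable_lne_EFin (f : T -> R) : measurable_fun setT f ->
  measurable_fun setT (fun x => lne (f x)%:E).
Proof.
move=> mf; rewrite /lne; apply: measurable_fun_ifT => //.
- exact: measurable_fun_ler.
- apply/measurable_EFinP; exact: (measurableT_comp (@measurable_ln R)).
Qed.

End extended_integrals.

(* [ln t <= t - 1] at [t = p / q], multiplied by [q]; the conventions
   [ln 0 = -oo] and [-oo * 0 = 0] cover the degenerate cases. *)
Lemma gibbs_pointwise (R : realType) (p q : R) : 0 <= p -> 0 <= q ->
  (lne p%:E * q%:E <= lne q%:E * q%:E + (p - q)%:E)%E.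
Proof.
move=> p0; rewrite le_eqVlt => /predU1P[<-|q0].
  by rewrite !mule0 add0e subr0 lee_fin.
move: p0; rewrite le_eqVlt => /predU1P[<-|p0].
  by rewrite le0_lneNy// gt0_mulNye ?leNye// lte_fin.
rewrite !lne_EFin// -!EFinM -EFinD lee_fin.
have r0 : 0 < p / q by rewrite divr_gt0.
have := @le_ln1Dx R (p / q - 1); rewrite (addrC 1) subrK -subr_gt0 opprK subrK.
move=> /(_ r0); rewrite ln_div// => H.
have := ler_wpM2r (ltW q0) H; rewrite mulrBl mulrBl divfK ?gt_eqF// mul1r; lra.
Qed.

(** * Transfer of integrals between weighted measures *)

Section weighted_change_of_variable.
Context d1 d2 d3 (X : measurableType d1) (Y : measurableType d2)
  (T : measurableType d3) (R : realType).
Local Open Scope ereal_scope.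
Import HBNNSimple.

(** The right-hand side sees [mu], [phi] and [g] only through the masses of preimages, and the
    simple functions [h n] live on the target space [T]. *)
Lemma ge0_integral_weighted_lim d (Z : measurableType d)
    (mu : {measure set Z -> \bar R}) (phi : Z -> T) (g : Z -> R) (f : T -> \bar R)
    (mf : measurable_fun setT f) :
  measurable_fun setT phi -> measurable_fun setT g -> (forall x, 0 <= g x)%R ->
  (forall x, 0 <= f x) ->
  let h := nnsfun_approx measurableT mf in
  \int[mu]_x (f (phi x) * (g x)%:E) =
  limn (fun n => \sum_(r \in range (h n))
    r%:E * \int[mu]_(x in phi @^-1` (h n @^-1` [set r])) (g x)%:E).
Proof.
move=> mphi mg g0 f0 h.
have mG : measurable_fun setT (EFin \o g) by exact/measurable_EFinP.
have mh n : measurable_fun setT (fun x => (h n (phi x))%:E).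
  by apply/measurable_EFinP; apply: (measurableT_comp _ mphi).
have fE x : f (phi x) * (g x)%:E = limn (fun n => (h n (phi x))%:E * (g x)%:E).
  apply/esym/cvg_lim => //; apply: cvgeZr => //.
  exact: (cvg_nnsfun_approx measurableT mf (fun t _ => f0 t)).
under eq_integral do rewrite fE.
rewrite monotone_convergence//; last 3 first.
- by move=> n; exact: emeasurable_funM.
- by move=> n x _; rewrite mule_ge0// lee_fin.
- move=> x _ a b ab; rewrite lee_wpmul2r ?lee_fin//.
  exact/lefP/nd_nnsfun_approx.
congr (limn _); apply/funext => n.
have mA r : measurable (phi @^-1` (h n @^-1` [set r])).
  by rewrite -[X in measurable X]setTI; exact: mphi.
transitivity (\int[mu]_x (\sum_(r \in range (h n))
    r%:E * ((\1_(phi @^-1` (h n @^-1` [set r])) x)%:E * (g x)%:E))).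
  apply: eq_integral => x _; rewrite {1}fimfunE -fsumEFin//.
  rewrite ge0_mule_fsuml => [|r]; last exact: nnfun_muleindic_ge0.
  by apply: eq_fsbigr => r _; rewrite EFinM muleA.
have mi r : measurable_fun setT
    (fun x => (\1_(phi @^-1` (h n @^-1` [set r])) x)%:E * (g x)%:E).
  apply: emeasurable_funM => //; apply/measurable_EFinP.
  exact: measurable_indic.
rewrite ge0_integral_fsum//; last 2 first.
- by move=> r; apply: emeasurable_funM => //; exact: mi.
- move=> r x _; rewrite muleA mule_ge0// ?lee_fin//.
  by have := nnfun_muleindic_ge0 (h n) r (phi x).
apply: eq_fsbigr => r rh.
rewrite ge0_integralZl//; last 2 first.
- by move=> x _; rewrite mule_ge0// lee_fin.
- by move: rh; rewrite inE => -[t _ <-]; rewrite lee_fin.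
congr (_ * _); rewrite [RHS]integral_mkcond; apply: eq_integral => x _.
by rewrite epatch_indic/= muleC.
Qed.

(** Two weighted measures with the same image on [T] give the same approximating sums at every
    stage, hence the same limit. *)
Lemma ge0_integral_weighted_ext (mu : {measure set X -> \bar R})
    (nu : {measure set Y -> \bar R}) (phi : X -> T) (psi : Y -> T)
    (g : X -> R) (h : Y -> R) (f : T -> \bar R) :
  measurable_fun setT phi -> measurable_fun setT psi ->
  measurable_fun setT g -> measurable_fun setT h ->
  (forall x, 0 <= g x)%R -> (forall y, 0 <= h y)%R ->
  (forall A, measurable A -> \int[mu]_(x in phi @^-1` A) (g x)%:E =
                             \int[nu]_(y in psi @^-1` A) (h y)%:E) ->
  measurable_fun setT f -> (forall t, 0 <= f t) ->
  \int[mu]_x (f (phi x) * (g x)%:E) = \int[nu]_y (f (psi y) * (h y)%:E).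
Proof.
move=> mphi mpsi mg mh g0 h0 gh mf f0.
rewrite !(@ge0_integral_weighted_lim _ _ _ _ _ _ mf)//.
congr (limn _); apply/funext => n; apply: eq_fsbigr => r _; rewrite gh//.
Qed.

End weighted_change_of_variable.

(** * Finiteness of the evidence *)

Lemma measurable_tuple_cons1 d (T : measurableType d) n (x : T) :
  measurable_fun [set: n.-tuple T] (fun t : n.-tuple T => tcons (x, t)).
Proof.
apply: (measurableT_comp (@measurable_tcons _ T n)).
exact: measurable_fun_pair.
Qed.

Section chain_integral.
Context d (T : measurableType d) (R : realType).
Variable mu : {sigma_finite_measure set T -> \bar R}.

Lemma measurable_chain n (e : 'I_n -> T -> T -> R) :
  (forall k, measurable_fun [set: T * T] (fun p => e k p.1 p.2)) ->
  measurable_fun [set: n.+1.-tuple T] (fun t : n.+1.-tuple T =>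
    \prod_(k < n) e k (tnth t (cur k)) (tnth t (nxt k))).
Proof.
move=> me; apply: measurable_prod => k _.
exact: (measurableT_comp (me k)
  (measurable_fun_pair (measurable_tnth (cur k)) (measurable_tnth (nxt k)))).
Qed.

(** The kernel bounds are uniform in the current point. By induction, the rest of the chain is at
    most a constant wherever it starts, and this constant leaves the integral over the first
    step. *)
Lemma chain_integral_le n (e : 'I_n -> T -> T -> R) (C : 'I_n -> R) :
  (forall k, measurable_fun [set: T * T] (fun p => e k p.1 p.2)) ->
  (forall k x y, 0 <= e k x y) -> (forall k, 0 <= C k) ->
  (forall k x, \int[mu]_y (e k x y)%:E <= (C k)%:E)%E ->
  forall x, (\int[measure_power mu n]_t
    (\prod_(k < n) e k (tnth (tcons (x, t)) (cur k)) (tnth (tcons (x, t)) (nxt k)))%:E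
    <= (\prod_(k < n) C k)%:E)%E.
Proof.
elim: n e C => [|n IH] e C me e0 C0 eC x.
  under eq_integral do rewrite big_ord0.
  by rewrite big_ord0 integral_dirac// diracE in_setT mul1e.
have M k (z : T) : measurable_fun [set: T] (e k z).
  exact: (measurableT_comp (me k) (measurable_pair1 z)).
pose e' (k : 'I_n) := e (lift ord0 k).
have E a t : \prod_(k < n.+1) e k (tnth (tcons (x, tcons (a, t))) (cur k))
      (tnth (tcons (x, tcons (a, t))) (nxt k)) =
    e ord0 x a * \prod_(k < n) e' k (tnth (tcons (a, t)) (cur k))
      (tnth (tcons (a, t)) (nxt k)).
  rewrite big_ord_recl; congr (e _ _ _ * _).
  apply: eq_bigr => k _; rewrite /e'; congr (e _ _ _); last by rewrite tnthS.
  by rewrite (_ : cur _ = lift ord0 (cur k)) ?tnthS//; exact/val_inj.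
rewrite ge0_integral_measure_powerS//; last 2 first.
- apply/measurable_EFinP.
  exact: (measurableT_comp (measurable_chain me) (measurable_tuple_cons1 x)).
- by move=> t; rewrite lee_fin; apply: prodr_ge0 => k _.
under eq_integral do under eq_integral do rewrite E EFinM.
have me' k : measurable_fun [set: T * T] (fun p => e' k p.1 p.2) by exact: me.
have mt a : measurable_fun [set: n.-tuple T] (fun t : n.-tuple T =>
    \prod_(k < n) e' k (tnth (tcons (a, t)) (cur k)) (tnth (tcons (a, t)) (nxt k))).
  exact: (measurableT_comp (measurable_chain me') (measurable_tuple_cons1 a)).
rewrite big_ord_recl.
apply: (@le_trans _ _ (\int[mu]_a ((\prod_(i < n) C (lift ord0 i))%:E *
    (e ord0 x a)%:E))%E); last first.
  rewrite ge0_integralZl_EFin//; first 1 last.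
  - by move=> a _; rewrite lee_fin.
  - exact/measurable_EFinP.
  - by apply: prodr_ge0.
  by rewrite muleC EFinM lee_wpmul2r// lee_fin; exact: prodr_ge0.
under eq_integral => a _.
  rewrite ge0_integralZl_EFin//; first 1 last.
  - by move=> t _; rewrite lee_fin; apply: prodr_ge0 => k _; exact: e0.
  - exact/measurable_EFinP.
  over.
apply: ge0_le_integral => //.
- move=> a _; rewrite mule_ge0 ?lee_fin//; apply: integral_ge0 => t _.
  by rewrite lee_fin; apply: prodr_ge0 => k _; exact: e0.
- apply: emeasurable_funM; first exact/measurable_EFinP.
  apply: (@measurable_fun_fubini_tonelli_F _ _ _ _ _ (measure_power mu n) (fun p =>
    (\prod_(k < n) e' k (tnth (tcons p) (cur k)) (tnth (tcons p) (nxt k)))%:E)).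
    apply/measurable_EFinP.
    exact: (measurableT_comp (measurable_chain me') (@measurable_tcons _ T n)).
  by move=> p; rewrite lee_fin; apply: prodr_ge0 => k _; exact: e0.
- by apply/measurable_EFinP; exact: measurable_funM.
- move=> a _; rewrite [leRHS]muleC; apply: lee_wpmul2l; first by rewrite lee_fin.
  exact: (IH e' (fun k => C (lift ord0 k)) me' (fun k => e0 _) (fun k => C0 _)
    (fun k => eC _)).
Qed.

End chain_integral.

Section posterior.
Context (R : realType) (nx nu ny m N : nat).
Variables (u : 'I_N -> 'cV[R]_nu) (y : 'I_N -> 'cV[R]_ny).
Implicit Types (th : params R nx nu ny m) (z : modes m N).

Lemma measurable_emission th k z :
  measurable_fun [set: states R nx N] (fun x : states R nx N => emission u y th k x z).
Proof.
apply: measurable_gauss.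
  apply: measurable_mx_col; first exact: measurable_mx_cst.
  by apply: measurable_mx_vec; exact: measurable_tnth.
apply: measurable_mxM; first exact: measurable_mx_cst.
apply: measurable_mx_col; last exact: measurable_mx_cst.
by apply: measurable_mx_vec; exact: measurable_tnth.
Qed.

Lemma transition_ge0 th k z : admissible th -> 0 <= transition th k z.
Proof. by move=> [_ T0 _]; rewrite divr_ge0// sumr_ge0. Qed.

Lemma joint_ge0 th x z : admissible th -> 0 <= joint u y th x z.
Proof.
move=> ath; have [[_ i0 _] T0 sP] := ath.
rewrite mulr_ge0// prodr_ge0// => k _.
by rewrite mulr_ge0 ?transition_ge0// ltW// gauss_gt0.
Qed.

Lemma measurable_joint th z : admissible th ->
  measurable_fun [set: states R nx N] (fun x : states R nx N => joint u y th x z).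
Proof.
move=> [[mi _ _] _ _]; apply: measurable_funM.
  exact: (measurableT_comp (mi _) (@measurable_tnth _ _ _ ord0)).
apply: measurable_prod => k _; apply: measurable_funM => //.
exact: measurable_emission.
Qed.

(** For each of the finitely many mode paths, [integral_gauss_tail_le] bounds every kernel
    uniformly, [chain_integral_le] multiplies the bounds, and the initial density has mass at most
    1. *)
Lemma evidence_fin_num th : admissible th -> evidence u y th \is a fin_num.
Proof.
move=> ath; have [[mi i0 i1] T0 sP] := ath.
rewrite ge0_fin_numE; last first.
  by apply: sume_ge0 => z _; apply: integral_ge0 => x _; rewrite lee_fin joint_ge0.
rewrite /evidence; apply: lte_sum_pinfty => z _.
have /choice[C CP] : forall k : 'I_N, exists c : R, 0 <= c /\
    forall x, (\int[leb R nx]_x' (gauss (yx y k (vec x'))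
    (Gam th (z (cur k)) *m xu u k (vec x)) (Pi th (z (cur k))))%:E <= c%:E)%E.
  move=> k; have [c c0 cP] := integral_gauss_tail_le (y k) (sP (z (cur k))).
  by exists c; split => // x; exact: cP.
pose e k (x x' : euclid R nx) := gauss (yx y k (vec x'))
    (Gam th (z (cur k)) *m xu u k (vec x)) (Pi th (z (cur k))) * transition th k z.
have mg k : measurable_fun [set: euclid R nx * euclid R nx]
    (fun p : euclid R nx * euclid R nx => gauss (yx y k (vec p.2))
    (Gam th (z (cur k)) *m xu u k (vec p.1)) (Pi th (z (cur k)))).
  apply: measurable_gauss.
    apply: measurable_mx_col; first exact: measurable_mx_cst.
    by apply: measurable_mx_vec.
  apply: measurable_mxM; first exact: measurable_mx_cst.
  apply: measurable_mx_col; last exact: measurable_mx_cst.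
  by apply: measurable_mx_vec.
have me k : measurable_fun [set: euclid R nx * euclid R nx]
    (fun p : euclid R nx * euclid R nx => e k p.1 p.2).
  by apply: measurable_funM => //; exact: mg.
have e0 k x x' : 0 <= e k x x'.
  by rewrite mulr_ge0 ?transition_ge0// ltW// gauss_gt0.
have eC k x : (\int[leb R nx]_x' (e k x x')%:E <= (C k * transition th k z)%:E)%E.
  under eq_integral do rewrite EFinM.
  rewrite ge0_integralZr//; last 3 first.
  - apply/measurable_EFinP; apply: measurable_gauss.
      apply: measurable_mx_col; first exact: measurable_mx_cst.
      by apply: measurable_mx_vec.
    exact: measurable_mx_cst.
  - by move=> x' _; rewrite lee_fin ltW// gauss_gt0.
  - by rewrite lee_fin transition_ge0.
  by rewrite (EFinM (C k)) lee_wpmul2r ?lee_fin ?transition_ge0//; case: (CP k).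
have C0 k : 0 <= C k * transition th k z.
  by rewrite mulr_ge0 ?transition_ge0//; case: (CP k).
rewrite ge0_integral_measure_powerS//; last 2 first.
- by apply/measurable_EFinP; exact: measurable_joint.
- by move=> t; rewrite lee_fin joint_ge0.
pose K := \prod_(k < N) (C k * transition th k z).
have K0 : 0 <= K by exact: prodr_ge0.
have iz : (\int[leb R nx]_x (init th x (z ord0))%:E < +oo)%E.
  apply: (@le_lt_trans _ _ 1%E); last exact: ltry.
  rewrite -i1 (bigD1 (z ord0))//= leeDl// sume_ge0// => w _.
  by apply: integral_ge0 => x _; rewrite lee_fin.
apply: (@le_lt_trans _ _ (\int[leb R nx]_x ((init th x (z ord0))%:E * K%:E))%E).
  apply: ge0_le_integral => //.
  - move=> x _; apply: integral_ge0 => t _; rewrite lee_fin joint_ge0//.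
  - apply: (@measurable_fun_fubini_tonelli_F _ _ _ _ _
      (measure_power (leb R nx) N) (fun p => (joint u y th (tcons p) z)%:E)).
      apply/measurable_EFinP.
      exact: (measurableT_comp (measurable_joint z ath) (@measurable_tcons _ _ N)).
    by move=> p; rewrite lee_fin joint_ge0.
  - apply/measurable_EFinP; apply: measurable_funM => //; exact: mi.
  - move=> x _; rewrite /joint; under eq_integral do rewrite tnth0 EFinM /=.
    rewrite ge0_integralZl_EFin//; last 2 first.
    + by move=> t _; rewrite lee_fin prodr_ge0// => k _; exact: e0.
    + apply/measurable_EFinP.
      exact: (measurableT_comp (measurable_chain me) (measurable_tuple_cons1 x)).
    rewrite lee_wpmul2l ?lee_fin//.
    exact: (chain_integral_le me e0 C0 eC).
rewrite ge0_integralZr//.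
- by rewrite muleC lte_mul_pinfty// lee_fin.
- by apply/measurable_EFinP; exact: mi.
- by move=> x _; rewrite lee_fin.
Qed.

End posterior.

(** * The initial distribution *)

Section initial_distribution.
Context (R : realType) (nx nu ny m N : nat).
Variables (u : 'I_N -> 'cV[R]_nu) (y : 'I_N -> 'cV[R]_ny).
Variable th' : params R nx nu ny m.
Hypothesis ath' : admissible th'.
Hypothesis evidence_gt0 : (0 < evidence u y th')%E.

Local Notation post := (posterior u y th').

Lemma fine_evidence_gt0 : 0 < fine (evidence u y th').
Proof.
rewrite fine_gt0// evidence_gt0/=; have := evidence_fin_num u y ath'.
by rewrite fin_numE ltey => /andP[].
Qed.

Lemma posterior_ge0 x z : 0 <= post x z.
Proof. by rewrite divr_ge0 ?joint_ge0// ltW// fine_evidence_gt0. Qed.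

Lemma measurable_posterior z :
  measurable_fun [set: states R nx N] (fun x : states R nx N => post x z).
Proof. by apply: measurable_funM => //; exact: measurable_joint. Qed.

Lemma sum_integral_posterior :
  (\sum_(z : modes m N) \int[leb_states R nx N]_x (post x z)%:E = 1)%E.
Proof.
have e0 := fine_evidence_gt0.
have E z : (\int[leb_states R nx N]_x (post x z)%:E =
    \int[leb_states R nx N]_x (joint u y th' x z)%:E * (fine (evidence u y th'))^-1%:E)%E.
  under eq_integral do rewrite EFinM.
  rewrite ge0_integralZr//.
  - by apply/measurable_EFinP; exact: measurable_joint.
  - by move=> x _; rewrite lee_fin joint_ge0.
  - by rewrite lee_fin invr_ge0 ltW.
under eq_bigr do rewrite E.
rewrite -ge0_sume_distrl; last first.
  by move=> z _; apply: integral_ge0 => x _; rewrite lee_fin joint_ge0.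
rewrite -/(evidence u y th') -(fineK (evidence_fin_num u y ath')) -EFinM.
by rewrite divff// gt_eqF.
Qed.

Lemma integral_posterior_le1 z :
  (0 <= \int[leb_states R nx N]_x (post x z)%:E <= 1)%E.
Proof.
have h (w : modes m N) : (0 <= \int[leb_states R nx N]_x (post x w)%:E)%E.
  by apply: integral_ge0 => x _; rewrite lee_fin posterior_ge0.
by rewrite h -sum_integral_posterior (bigD1 z)//= leeDl// sume_ge0.
Qed.

(** Left in [\bar R]: only finiteness for almost every [x1] is used, and there the [fine] in
    [smoothed1] changes nothing. *)
Definition slice (z : modes m N) (x1 : euclid R nx) : \bar R :=
  (\int[measure_power (leb R nx) N]_xs (post (tcons (x1, xs)) z)%:E)%E.

Lemma slice_ge0 z x1 : (0 <= slice z x1)%E.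
Proof. by apply: integral_ge0 => xs _; rewrite lee_fin posterior_ge0. Qed.

Lemma measurable_slice z : measurable_fun [set: euclid R nx] (slice z).
Proof.
apply: (@measurable_fun_fubini_tonelli_F _ _ _ _ _
  (measure_power (leb R nx) N) (fun p => (post (tcons p) z)%:E)).
  apply/measurable_EFinP.
  exact: (measurableT_comp (measurable_posterior z) (@measurable_tcons _ _ N)).
by move=> p; rewrite lee_fin posterior_ge0.
Qed.

Let ge0_integral_slice z (f : euclid R nx -> \bar R) :
  measurable_fun [set: euclid R nx] f -> (forall x, 0 <= f x)%E ->
  (\int[leb_states R nx N]_x (f (tnth x ord0) * (post x z)%:E) =
   \int[leb R nx]_x1 (f x1 * slice z x1))%E.
Proof.
move=> mf f0; rewrite ge0_integral_measure_powerS; last 2 first.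
- apply: emeasurable_funM.
    exact: (measurableT_comp mf (@measurable_tnth _ _ _ ord0)).
  by apply/measurable_EFinP; exact: measurable_posterior.
- by move=> t; rewrite mule_ge0// lee_fin posterior_ge0.
apply: eq_integral => x1 _; under eq_integral do rewrite tnth0 /=.
rewrite ge0_integralZl//.
- apply/measurable_EFinP.
  exact: (measurableT_comp (measurable_posterior z) (measurable_tuple_cons1 x1)).
- by move=> t _; rewrite lee_fin posterior_ge0.
Qed.

Lemma integral_slice z (f : euclid R nx -> \bar R) :
  measurable_fun [set: euclid R nx] f ->
  (\int[leb_states R nx N]_x (f (tnth x ord0) * (post x z)%:E) =
   \int[leb R nx]_x1 (f x1 * slice z x1))%E.
Proof.
move=> mf; have mp := measurable_funepos mf; have mn := measurable_funeneg mf.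
rewrite (integralM_funeposneg _ _ (slice_ge0 z)).
rewrite -!ge0_integral_slice//.
have p0 x : (0 <= (post x z)%:E)%E by rewrite lee_fin posterior_ge0.
pose h (x : states R nx N) := tnth x ord0.
rewrite (integralM_funeposneg _ (f \o h) p0).
by rewrite funepos_comp funeneg_comp.
Qed.

Lemma smoothed1_ge0 x1 z1 : 0 <= smoothed1 u y th' x1 z1.
Proof. by apply: fine_ge0; apply: sume_ge0 => z _; exact: slice_ge0. Qed.

Lemma measurable_smoothed1 z1 :
  measurable_fun [set: euclid R nx] ((smoothed1 u y th')^~ z1).
Proof.
apply: (measurableT_comp (@fine_measurable R _ measurableT)).
under eq_fun do rewrite -big_filter.
by apply: emeasurable_sum => z; exact: measurable_slice.
Qed.

(** The sum of the slices has a finite integral, hence is finite almost everywhere; off a null set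
    it agrees with its [fine], which is [smoothed1]. *)
Lemma integral_smoothed1 z1 (f : euclid R nx -> \bar R) :
  measurable_fun [set: euclid R nx] f ->
  (\sum_(z : modes m N | z ord0 == z1)
     \int[leb_states R nx N]_x (f (tnth x ord0) * (post x z)%:E) =
   \int[leb R nx]_x1 (f x1 * (smoothed1 u y th' x1 z1)%:E))%E.
Proof.
move=> mf; under eq_bigr do rewrite integral_slice//.
rewrite integral_sum_weights//; last 2 first.
- by move=> z; exact: measurable_slice.
- by move=> z x; exact: slice_ge0.
pose S x1 := (\sum_(z : modes m N | z ord0 == z1) slice z x1)%E.
have mS : measurable_fun [set: euclid R nx] S.
  rewrite /S; under eq_fun do rewrite -big_filter.
  by apply: emeasurable_sum => z; exact: measurable_slice.
have S0 x1 : (0 <= S x1)%E by apply: sume_ge0 => z _; exact: slice_ge0.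
have iS : (leb R nx).-integrable setT S.
  apply/integrableP; split => //.
  under eq_integral do rewrite gee0_abs//.
  rewrite /S; under eq_integral do rewrite -big_filter.
  rewrite ge0_integral_sum//; last 2 first.
  - by move=> z; exact: measurable_slice.
  - by move=> z x _; exact: slice_ge0.
  apply: lte_sum_pinfty => z _.
  have -> : (\int[leb R nx]_x slice z x = \int[leb_states R nx N]_x (post x z)%:E)%E.
    transitivity (\int[leb R nx]_x (cst 1 x * slice z x))%E.
      by apply: eq_integral => x _; rewrite mul1e.
    rewrite -integral_slice; last exact: measurable_cst.
    by apply: eq_integral => x _; rewrite mul1e.
  case/andP: (integral_posterior_le1 z) => _ /le_lt_trans; apply; exact: ltry.
apply: ae_eq_integral => //.
- exact: emeasurable_funM.
- apply: emeasurable_funM => //; apply/measurable_EFinP; exact: measurable_smoothed1.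
- have := integrable_ae measurableT iS.
  by apply: filterS => x1 /= /(_ I) fS _; rewrite /smoothed1 -/(slice _ _) fineK.
Qed.

Lemma sum_integral_smoothed1 (F : 'I_m -> euclid R nx -> \bar R) :
  (forall z1, measurable_fun [set: euclid R nx] (F z1)) ->
  (\sum_(z : modes m N) \int[leb_states R nx N]_x (F (z ord0) (tnth x ord0) * (post x z)%:E) =
   \sum_z1 \int[leb R nx]_x1 (F z1 x1 * (smoothed1 u y th' x1 z1)%:E))%E.
Proof.
move=> mF; rewrite (partition_big (fun z : modes m N => z ord0) predT)//=.
apply: eq_bigr => z1 _; rewrite -integral_smoothed1//.
by apply: eq_bigr => z /eqP ->.
Qed.

Lemma smoothed1_density : is_density (smoothed1 u y th').
Proof.
split; [exact: measurable_smoothed1|exact: smoothed1_ge0|].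
rewrite -sum_integral_posterior.
have := @sum_integral_smoothed1 (fun _ _ => 1%E) (fun=> measurable_cst _).
under eq_bigr do under eq_integral do rewrite mul1e.
by under [RHS]eq_bigr do under eq_integral do rewrite mul1e.
Qed.

(** Minus the cross-entropy of [p] relative to the smoothed density. *)
Definition init_score (p : euclid R nx -> 'I_m -> R) : \bar R :=
  (\sum_z1 \int[leb R nx]_x1 (lne (p x1 z1)%:E * (smoothed1 u y th' x1 z1)%:E))%E.

Lemma density_integrable (p : euclid R nx -> 'I_m -> R) z1 : is_density p ->
  (leb R nx).-integrable setT (EFin \o p^~ z1).
Proof.
move=> [mp p0 p1]; apply/integrableP; split; first by apply/measurable_EFinP; exact: mp.
under eq_integral do rewrite /= ger0_norm//.
apply: (@le_lt_trans _ _ 1%E); last exact: ltry.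
rewrite -p1 (bigD1 z1)//= leeDl// sume_ge0// => z _.
by apply: integral_ge0 => x _; rewrite lee_fin.
Qed.

(** [gibbs_pointwise] is integrated although the integral of [q ln q] may be infinite: only the
    correction [p - q] is integrable, and that is what [integralD_integrable] requires. *)
Lemma init_score_le (p : euclid R nx -> 'I_m -> R) : is_density p ->
  (init_score p <= init_score (smoothed1 u y th'))%E.
Proof.
move=> dp; have dq := smoothed1_density; set q := smoothed1 u y th' in dq *.
have [mp p0 p1] := dp; have [mq q0 q1] := dq.
have mlne (r : euclid R nx -> 'I_m -> R) z : is_density r ->
    measurable_fun [set: euclid R nx] (fun x => (lne (r x z)%:E * (q x z)%:E)%E).
  move=> [mr _ _]; apply: emeasurable_funM; last by apply/measurable_EFinP; exact: mq.
  by apply: measurable_lne_EFin; exact: mr.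
have ip z := density_integrable z dp; have iq z := density_integrable z dq.
apply: (@le_trans _ _ (\sum_z1 (\int[leb R nx]_x (lne (q x z1)%:E * (q x z1)%:E) +
    (\int[leb R nx]_x (p x z1)%:E - \int[leb R nx]_x (q x z1)%:E)))%E).
  apply: lee_sum => z1 _.
  rewrite -(integralB_EFin _ (ip z1) (iq z1))//.
  rewrite -(integralD_integrable (g := fun x => p x z1 - q x z1))//; last 2 first.
  - exact: mlne.
  - exact: (integrableB _ (ip z1) (iq z1)).
  apply: le_integral_measurable; first exact: mlne.
  - apply: emeasurable_funD; first exact: mlne.
    by apply/measurable_EFinP; apply: measurable_funB; [exact: mp|exact: mq].
  - by move=> x; exact: gibbs_pointwise.
(* The masses of [p] and [q] may differ mode by mode; they cancel only in the sum over the modes. *)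
rewrite big_split/= (sume_ge0B _ _ (a := fun z => \int[leb R nx]_x (p x z)%:E)
  (b := fun z => \int[leb R nx]_x (q x z)%:E))%E; last 2 first.
- by move=> z; apply: integral_ge0 => x _; rewrite lee_fin.
- by move=> z; apply: integral_ge0 => x _; rewrite lee_fin.
by rewrite p1 q1 subee// adde0.
Qed.

End initial_distribution.

(** * Expectations under the mixture *)

Section weighted_expectation.
Context d (T : measurableType d) (R : realType).
Variable mu : {measure set T -> \bar R}.

(** Integrability travels with the value, so that the closure properties below compose without side
    conditions. *)
Definition is_expect a b (g : T -> R) (F : T -> 'M[R]_(a, b)) (V : 'M[R]_(a, b)) : Prop :=
  forall i j, mu.-integrable setT (fun x => (F x i j * g x)%:E) /\
    (\int[mu]_x (F x i j * g x)%:E = (V i j)%:E)%E.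

Lemma is_expectZD a b g (F H : T -> 'M[R]_(a, b)) V W (c e : R) :
  is_expect g F V -> is_expect g H W ->
  is_expect g (fun x => c *: F x + e *: H x) (c *: V + e *: W).
Proof.
move=> FV HW i j; have [iF eF] := FV i j; have [iH eH] := HW i j.
have E x : (((c *: F x + e *: H x) i j * g x)%:E =
    c%:E * (F x i j * g x)%:E + e%:E * (H x i j * g x)%:E)%E.
  by rewrite -!EFinM -EFinD !mxE mulrDl !mulrA.
have icF := integrableZl measurableT c iF; have icH := integrableZl measurableT e iH.
split; first by apply: eq_integrable (integrableD measurableT icF icH) => // x _; rewrite E.
under eq_integral do rewrite E.
by rewrite integralD// !integralZl// eF eH -!EFinM -EFinD !mxE.
Qed.

Lemma is_expect_sum a b g (I : Type) (s : seq I) (F : I -> T -> 'M[R]_(a, b)) V :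
  (forall k, is_expect g (F k) (V k)) ->
  is_expect g (fun x => \sum_(k <- s) F k x) (\sum_(k <- s) V k).
Proof.
move=> FV; elim: s => [|k s IH].
  under [X in is_expect _ X]eq_fun do rewrite big_nil.
  rewrite big_nil => i j; under eq_fun do rewrite mxE mul0r.
  by split; [exact: integrable0|rewrite integral0 mxE].
rewrite big_cons; have := is_expectZD 1 1 (FV k) IH; rewrite !scale1r.
rewrite (_ : (fun x => 1 *: F k x + _) = (fun x => \sum_(l <- k :: s) F l x))//.
by apply/funext => x; rewrite !scale1r big_cons.
Qed.

Lemma is_expect_mul a b p q g (F : T -> 'M[R]_(a, b)) V
    (A : 'M[R]_(p, a)) (B : 'M[R]_(b, q)) :
  is_expect g F V -> is_expect g (fun x => A *m F x *m B) (A *m V *m B).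
Proof.
move=> FV i j; pose r : seq ('I_a * 'I_b) := index_enum _.
(* An entry of the product is a finite linear combination of entries of [F]; written with 1 by 1
   matrices, it falls under [is_expect_sum]. *)
have H : is_expect g (fun x => \sum_(s <- r) (A i s.1 * B s.2 j) *: const_mx (F x s.1 s.2)
    : 'M[R]_1) (\sum_(s <- r) (A i s.1 * B s.2 j) *: const_mx (V s.1 s.2)).
  apply: is_expect_sum => s i' j'; have [iF eF] := FV s.1 s.2.
  have E x : (((A i s.1 * B s.2 j) *: (const_mx (F x s.1 s.2) : 'M[R]_1)) i' j' * g x)%:E =
      ((A i s.1 * B s.2 j)%:E * (F x s.1 s.2 * g x)%:E)%E.
    by rewrite -EFinM !mxE mulrA.
  split; first by apply: eq_integrable (integrableZl measurableT _ iF) => // x _; rewrite E.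
  by under eq_integral do rewrite E; rewrite integralZl// eF -EFinM !mxE.
have E (M : 'M[R]_(a, b)) : (A *m M *m B) i j =
    (\sum_(s <- r) (A i s.1 * B s.2 j) *: const_mx (M s.1 s.2) : 'M[R]_1) ord0 ord0.
  rewrite summxE mxE; under eq_bigr do rewrite mxE mulr_suml.
  rewrite exchange_big pair_big/=; apply: eq_bigr => s _.
  by rewrite !mxE mulrAC.
have [iH eH] := H ord0 ord0; split.
  by apply: eq_integrable iH => // x _; rewrite E.
by under eq_integral do rewrite E; rewrite eH E.
Qed.

Lemma is_expect_tr a b g (F : T -> 'M[R]_(a, b)) V :
  is_expect g F V -> is_expect g (fun x => (F x)^T) V^T.
Proof.
move=> FV i j; have [iF eF] := FV j i; split.
  by apply: eq_integrable iF => // x _; rewrite mxE.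
by under eq_integral do rewrite mxE; rewrite eF mxE.
Qed.

Lemma is_expect_trace a g (F : T -> 'M[R]_a) V : is_expect g F V ->
  mu.-integrable setT (fun x => (\tr (F x) * g x)%:E) /\
  (\int[mu]_x (\tr (F x) * g x)%:E = (\tr V)%:E)%E.
Proof.
move=> FV; have E x : ((\tr (F x) * g x)%:E = \sum_i (F x i i * g x)%:E)%E.
  by rewrite /mxtrace mulr_suml -sumEFin.
split.
  apply: eq_integrable (integrable_sum measurableT _ _) => //.
  - by move=> x _; rewrite E.
  - by move=> i _; case: (FV i i).
under eq_integral do rewrite E.
rewrite integral_sum// => [|i]; last by case: (FV i i).
by under eq_bigr do rewrite (FV _ _).2; rewrite sumEFin.
Qed.

Lemma is_expect_mix a b (I : Type) (s : seq I) (w : I -> R) (g : I -> T -> R)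
    (F : T -> 'M[R]_(a, b)) V :
  (forall l, is_expect (g l) F (V l)) ->
  is_expect (fun x => \sum_(l <- s) w l * g l x) F (\sum_(l <- s) w l *: V l).
Proof.
move=> FV i j; have E x : ((F x i j * (\sum_(l <- s) w l * g l x))%:E =
    \sum_(l <- s) (w l)%:E * (F x i j * g l x)%:E)%E.
  rewrite mulr_sumr -sumEFin; apply: eq_bigr => l _.
  by rewrite -EFinM mulrCA.
have iF l := integrableZl measurableT (w l) (FV l i j).1.
split.
  by apply: eq_integrable (integrable_sum measurableT _ (fun l _ => iF l)) => // x _; rewrite E.
under eq_integral do rewrite E.
rewrite integral_sum//.
transitivity (\sum_(l <- s) (w l * V l i j)%:E)%E.
  by apply: eq_bigr => l _; have [iFl eFl] := FV l i j; rewrite integralZl// eFl.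
by rewrite sumEFin summxE; congr _%:E; apply: eq_bigr => l _; rewrite mxE.
Qed.

End weighted_expectation.

(** * Second moments and total masses of the mixtures *)

Section mixture_scores.
Context (R : realType) (nx nu ny m N : nat).
Variables (u : 'I_N -> 'cV[R]_nu) (y : 'I_N -> 'cV[R]_ny).
Variable G : mixtures R nx m N.
Hypothesis wgt_ge0 : forall k i j (l : 'I_(ncomp G k)), 0 <= wgt i j l.
Hypothesis cov_spd : forall k i j (l : 'I_(ncomp G k)), spd (cov i j l).

Local Notation X := (euclid R nx).
Local Notation mix := (mixture_density G).

Lemma mixture_density_ge0 k i j p : 0 <= mix k i j p.
Proof. by apply: sumr_ge0 => l _; rewrite mulr_ge0// ltW// gauss_gt0. Qed.

Lemma measurable_mx_pair :
  measurable_mx (fun p : X * X => col_mx (vec p.1) (vec p.2)).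
Proof. by apply: measurable_mx_col; apply: measurable_mx_vec. Qed.

Lemma measurable_mixture_density k i j :
  measurable_fun [set: X * X] (mix k i j).
Proof.
apply: measurable_sum => l; apply: measurable_funM => //; apply: measurable_gauss.
  exact: measurable_mx_pair.
exact: measurable_mx_cst.
Qed.

(** At most linear growth of the entries, so that products of two of them have the quadratic growth
    that [integrable_quadratic_gauss] accepts. *)
Let quadratic_bounded a (f : X * X -> 'cV[R]_a) := exists2 C : R, 0 <= C &
  forall p i, f p i ord0 ^+ 2 <= C * (1 + quad 1%:M (col_mx (vec p.1) (vec p.2))).

Let quad_col (x x' : 'cV[R]_nx) :
  quad 1%:M (col_mx x x') = quad 1%:M x + quad 1%:M x'.
Proof.
rewrite !quad1 big_split_ord/=.
by congr (_ + _); apply: eq_bigr => i _; rewrite ?col_mxEu ?col_mxEd.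
Qed.

Let sqr_le_quad n (x : 'cV[R]_n) i : x i ord0 ^+ 2 <= quad 1%:M x.
Proof.
rewrite quad1 (bigD1 i)//= lerDl; apply: sumr_ge0 => j _; exact: sqr_ge0.
Qed.

Let quad1_ge0 n (x : 'cV[R]_n) : 0 <= quad 1%:M x.
Proof. by apply: spd_quad_ge0; exact: spd1. Qed.

Let quadratic_bounded_xu k : quadratic_bounded (fun p => xu u k (vec p.1)).
Proof.
exists (1 + quad 1%:M (u k)) => [|p i]; first by rewrite addr_ge0.
have h : xu u k (vec p.1) i ord0 ^+ 2 <= quad 1%:M (vec p.1) + quad 1%:M (u k).
  rewrite mxE; case: splitP => j _.
    by apply: le_trans (sqr_le_quad _ j) _; rewrite lerDl.
  by apply: le_trans (sqr_le_quad _ j) _; rewrite lerDr.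
apply: (le_trans h); rewrite quad_col.
have := mulr_ge0 (quad1_ge0 (u k)) (quad1_ge0 (vec p.1)).
have := mulr_ge0 (quad1_ge0 (u k)) (quad1_ge0 (vec p.2)).
have := quad1_ge0 (vec p.2); lra.
Qed.

Let quadratic_bounded_yx k : quadratic_bounded (fun p => yx y k (vec p.2)).
Proof.
exists (1 + quad 1%:M (y k)) => [|p i]; first by rewrite addr_ge0.
have h : yx y k (vec p.2) i ord0 ^+ 2 <= quad 1%:M (y k) + quad 1%:M (vec p.2).
  rewrite mxE; case: splitP => j _.
    by apply: le_trans (sqr_le_quad _ j) _; rewrite lerDl.
  by apply: le_trans (sqr_le_quad _ j) _; rewrite lerDr.
apply: (le_trans h); rewrite quad_col.
have := mulr_ge0 (quad1_ge0 (y k)) (quad1_ge0 (vec p.1)).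
have := mulr_ge0 (quad1_ge0 (y k)) (quad1_ge0 (vec p.2)).
have := quad1_ge0 (vec p.1); lra.
Qed.

Let measurable_xu k : measurable_mx (fun p : X * X => xu u k (vec p.1)).
Proof.
apply: measurable_mx_col; last exact: measurable_mx_cst.
by apply: measurable_mx_vec.
Qed.

Let measurable_yx k : measurable_mx (fun p : X * X => yx y k (vec p.2)).
Proof.
apply: measurable_mx_col; first exact: measurable_mx_cst.
by apply: measurable_mx_vec.
Qed.

Let is_expect_outer a b (f : X * X -> 'cV[R]_a) (h : X * X -> 'cV[R]_b)
    (F : 'cV[R]_nx -> 'cV[R]_nx -> 'M[R]_(a, b)) k i j (l : 'I_(ncomp G k)) :
  quadratic_bounded f -> quadratic_bounded h -> measurable_mx f -> measurable_mx h ->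
  (forall p, F (vec p.1) (vec p.2) = f p *m (h p)^T) ->
  is_expect (@pair_leb R nx)
    (fun p => gauss (col_mx (vec p.1) (vec p.2)) (mean i j l) (cov i j l))
    (fun p => F (vec p.1) (vec p.2)) (pair_expect (mean i j l) (cov i j l) F).
Proof.
move=> [C C0 fC] [D D0 hD] mf mh FE a' b'.
have FE' p : F (vec p.1) (vec p.2) a' b' = f p a' ord0 * h p b' ord0.
  by rewrite FE mxE big_ord1 mxE.
have iF : (@pair_leb R nx).-integrable setT (fun p => (F (vec p.1) (vec p.2) a' b' *
    gauss (col_mx (vec p.1) (vec p.2)) (mean i j l) (cov i j l))%:E).
  (* The constant comes from [|r s| <= r^2 + s^2]. *)
  apply: (@integrable_quadratic_gauss _ _ _ _ _ (C + D)) => //.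
    by under eq_fun do rewrite FE'; exact: measurable_funM.
  move=> p; rewrite FE' normrM mulrDl; apply: (le_trans _ (lerD (fC p a') (hD p b'))).
  rewrite -normrM ler_norml; set r := f p _ _; set s := h p _ _.
  have := sqr_ge0 (r - s); have := sqr_ge0 (r + s).
  have := sqr_ge0 r; have := sqr_ge0 s.
  rewrite !sqrrD sqrrN mulrN !mulr2n; move=> *; apply/andP; split; lra.
(* [pair_expect] is a real-valued integral, that is, the [fine] of the extended one; integrability
   makes the two agree. *)
split=> //; rewrite mxE fineK//; exact: integrable_fin_num.
Qed.

Definition mix_expect k i j a b (F : 'cV[R]_nx -> 'cV[R]_nx -> 'M[R]_(a, b)) :=
  \sum_(l < ncomp G k) wgt i j l *: pair_expect (mean i j l) (cov i j l) F.

Let Fxx k (x x' : 'cV[R]_nx) := xu u k x *m (xu u k x)^T.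
Let Fyy k (x x' : 'cV[R]_nx) := yx y k x' *m (yx y k x')^T.
Let Fyx k (x x' : 'cV[R]_nx) := yx y k x' *m (xu u k x)^T.

Lemma is_expect_xx k i j : is_expect (@pair_leb R nx) (mix k i j)
  (fun p => Fxx k (vec p.1) (vec p.2)) (mix_expect k i j (Fxx k)).
Proof. by apply: is_expect_mix => l; exact: is_expect_outer. Qed.

Lemma is_expect_yy k i j : is_expect (@pair_leb R nx) (mix k i j)
  (fun p => Fyy k (vec p.1) (vec p.2)) (mix_expect k i j (Fyy k)).
Proof. by apply: is_expect_mix => l; exact: is_expect_outer. Qed.

Lemma is_expect_yx k i j : is_expect (@pair_leb R nx) (mix k i j)
  (fun p => Fyx k (vec p.1) (vec p.2)) (mix_expect k i j (Fyx k)).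
Proof. by apply: is_expect_mix => l; exact: is_expect_outer. Qed.

Lemma integral_mixture_density k i j :
  (@pair_leb R nx).-integrable setT (EFin \o mix k i j) /\
  (\int[@pair_leb R nx]_p (mix k i j p)%:E = (\sum_(l < ncomp G k) wgt i j l)%:E)%E.
Proof.
have mg (l : 'I_(ncomp G k)) : measurable_fun [set: X * X] (fun p : X * X =>
    (gauss (col_mx (vec p.1) (vec p.2)) (mean i j l) (cov i j l))%:E).
  apply/measurable_EFinP; apply: measurable_gauss; first exact: measurable_mx_pair.
  exact: measurable_mx_cst.
have E : (\int[@pair_leb R nx]_p (mix k i j p)%:E =
    (\sum_(l < ncomp G k) wgt i j l)%:E)%E.
  under eq_integral do rewrite -sumEFin.
  rewrite ge0_integral_sum//; last 2 first.
  - move=> l; under eq_fun do rewrite EFinM; exact: emeasurable_funM.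
  - by move=> l p _; rewrite lee_fin mulr_ge0// ltW// gauss_gt0.
  rewrite -sumEFin; apply: eq_bigr => l _; under eq_integral do rewrite EFinM.
  rewrite ge0_integralZl_EFin//.
  - by rewrite (integral_gauss_pair _ (cov_spd _ _ _)) mule1.
  - by move=> p _; rewrite lee_fin ltW// gauss_gt0.
split=> //; apply/integrableP; split.
  by apply/measurable_EFinP; exact: measurable_mixture_density.
under eq_integral do rewrite /= ger0_norm ?mixture_density_ge0//.
by rewrite E ltry.
Qed.

End mixture_scores.

(** * The emission terms *)

(* The three terms are added with [-oo] absorbing; when [c = -oo] the left-hand
   side is [-oo] or [0] according to whether [p] has positive mass. *)
Lemma integral_split_weighted d (T : measurableType d) (R : realType)
    (mu : {measure set T -> \bar R}) (a : T -> \bar R) (h p : T -> R) (c : \bar R) :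
  measurable_fun setT a -> measurable_fun setT h ->
  mu.-integrable setT (EFin \o p) -> (forall x, 0 <= p x) ->
  mu.-integrable setT (fun x => (h x * p x)%:E) -> c != +oo%E ->
  (\int[mu]_x ((a x + (h x)%:E + c) * (p x)%:E) =
   \int[mu]_x (a x * (p x)%:E) + \int[mu]_x (h x * p x)%:E +
   c * \int[mu]_x (p x)%:E)%E.
Proof.
move=> ma mh ip p0 ihp; have mp : measurable_fun setT (EFin \o p) by exact: measurable_int ip.
have map : measurable_fun setT (fun x => (a x * (p x)%:E)%E) by exact: emeasurable_funM.
have pfin := integrable_fin_num measurableT ip.
have pge : (0 <= \int[mu]_x (p x)%:E)%E by apply: integral_ge0 => x _; rewrite lee_fin.
have hfin := integrable_fin_num measurableT ihp.
case: c => [c| |]// _.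
  have icp := integrableZl measurableT c ip.
  have ihc : mu.-integrable setT (EFin \o (fun x => h x * p x + c * p x)).
    by apply: eq_integrable (integrableD measurableT ihp icp) => // x _; rewrite /= EFinD EFinM.
  transitivity (\int[mu]_x (a x * (p x)%:E + (h x * p x + c * p x)%:E))%E.
    apply: eq_integral => x _; rewrite -addeA -EFinD muleDl ?fin_num_adde_defl//.
    by rewrite -EFinM mulrDl.
  rewrite integralD_integrable// -addeA; congr (_ + _)%E.
  under eq_integral do rewrite EFinD (EFinM c).
  by rewrite integralD// integralZl.
under eq_integral do rewrite addeNy.
have -> : (\int[mu]_x (-oo * (p x)%:E) = -oo * \int[mu]_x (p x)%:E)%E.
  under eq_integral do rewrite -(oppeK (-oo * _))%E -mulNe/=.
  rewrite integral_ge0N; last by move=> x _; rewrite mule_ge0// lee_fin.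
  by rewrite ge0_integralZl// ?muleN//; [rewrite -mulNe|move=> x _; rewrite lee_fin].
have [p00|pN0] := eqVneq (\int[mu]_x (p x)%:E)%E 0%E; last first.
  by rewrite gt0_mulNye ?lt_neqAle 1?eq_sym ?pN0// addeNy.
rewrite p00 mule0 adde0.
(* Zero mass makes [p] vanish almost everywhere, and with it the two other integrals. *)
have pae : ae_eq mu setT (EFin \o p) (cst 0%E).
  apply/ae_eq_integral_abs => //; rewrite -[RHS]p00; apply: eq_integral => x _.
  by rewrite /= ger0_norm.
rewrite (ae_eq_integral (cst 0%E)) ?integral0//; last first.
  by apply: filterS pae => x /= /(_ I) [->] _; rewrite mule0.
rewrite (ae_eq_integral (cst 0%E)) ?integral0 ?adde0//; last first.
  by apply: filterS pae => x /= /(_ I) [->] _; rewrite mulr0.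
exact: measurable_int ihp.
Qed.

(** Without [+oo] among the terms, no sum has the form [+oo - oo], for which a negative factor
    breaks distributivity. The second conjunct serves the induction and the last hypothesis of
    [integral_split_weighted]. *)
Lemma lt_pinfty_sume_distrl (R : realType) (I : Type) (s : seq I) (t : I -> \bar R)
    (r : \bar R) : (forall i, t i != +oo%E) -> r \is a fin_num ->
  ((\sum_(i <- s) t i) * r = \sum_(i <- s) t i * r)%E /\ (\sum_(i <- s) t i)%E != +oo%E.
Proof.
move=> t1 rf; elim: s => [|i s [IH1 IH2]]; first by rewrite !big_nil mul0e.
rewrite !big_cons muleDl// ?IH1; last first.
  by move: IH2 (t1 i); case: (t i) => [?| |]//; case: (\sum_(j <- s) t j)%E.
by split => //; move: IH2 (t1 i); case: (t i) => [?| |]//; case: (\sum_(j <- s) t j)%E.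
Qed.

Section emission_score.
Context (R : realType) (nx nu ny m N : nat).
Variables (u : 'I_N -> 'cV[R]_nu) (y : 'I_N -> 'cV[R]_ny).
Variable G : mixtures R nx m N.
Hypothesis wgt_ge0 : forall k i j (l : 'I_(ncomp G k)), 0 <= wgt i j l.
Hypothesis cov_spd : forall k i j (l : 'I_(ncomp G k)), spd (cov i j l).

Local Notation X := (euclid R nx).
Local Notation mix := (mixture_density G).
Implicit Types (Gm : 'M[R]_(ny + nx, nx + nu)) (P : 'M[R]_(ny + nx)).

Definition log_emission (k : 'I_N) Gm P (p : X * X) : R :=
  ln (gauss (yx y k (vec p.2)) (Gm *m xu u k (vec p.1)) P).

Lemma measurable_log_emission k Gm P :
  measurable_fun [set: X * X] (log_emission k Gm P).
Proof.
apply: (measurableT_comp (@measurable_ln R)); apply: measurable_gauss.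
  apply: measurable_mx_col; first exact: measurable_mx_cst.
  by apply: measurable_mx_vec.
apply: measurable_mxM; first exact: measurable_mx_cst.
apply: measurable_mx_col; last exact: measurable_mx_cst.
by apply: measurable_mx_vec.
Qed.

(** The trace form is linear in the outer product of the residual, so expectations can be taken
    inside it. *)
Lemma ln_gauss n (x c : 'cV[R]_n) (Q : 'M[R]_n) : spd Q ->
  ln (gauss x c Q) =
  - (ln ((2 * pi) ^+ n * \det Q) / 2) - \tr (invmx Q *m ((x - c) *m (x - c)^T)) / 2.
Proof.
move=> sQ; have k0 := gauss_peak_gt0 sQ; set e := x - c.
have a0 : 0 < (2 * pi) ^+ n * \det Q :> R.
  by rewrite mulr_gt0 ?spd_det_gt0// exprn_gt0// mulr_gt0 ?pi_gt0.
rewrite /gauss [LHS]lnM ?posrE ?expR_gt0// expRK; congr (_ - _).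
  rewrite lnV ?posrE ?sqrtr_gt0//; congr (- _).
  have <- : ln (Num.sqrt ((2 * pi) ^+ n * \det Q)) * 2 = ln ((2 * pi) ^+ n * \det Q).
    by rewrite -[in RHS](sqr_sqrtr (ltW a0)) lnXn ?sqrtr_gt0// mulr_natr.
  by rewrite mulfK.
rewrite -/e; congr (_ / 2).
by rewrite mulmxA mxtrace_mulC mulmxA /mxtrace big_ord1.
Qed.

(** The weighted expectation of the residual outer product, expanded. For non-zero [c_m] it equals
    [c_m] times [Pi_update]. *)
Definition scatter z Gm : 'M[R]_(ny + nx) :=
  Phi y G z - Gm *m (Psi u y G z)^T - Psi u y G z *m Gm^T
  + Gm *m Sigma u G z *m Gm^T.

Definition emission_score z Gm P : R :=
  - ((c_m G z * ln ((2 * pi) ^+ (ny + nx) * \det P) + \tr (invmx P *m scatter z Gm)) / 2).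

Let scat k i j Gm : 'M[R]_(ny + nx) :=
  mix_expect G k i j (fun _ x' => yx y k x' *m (yx y k x')^T)
  - Gm *m (mix_expect G k i j (fun x x' => yx y k x' *m (xu u k x)^T))^T
  - mix_expect G k i j (fun x x' => yx y k x' *m (xu u k x)^T) *m Gm^T
  + Gm *m mix_expect G k i j (fun x _ => xu u k x *m (xu u k x)^T) *m Gm^T.

Let is_expect_residual k i j Gm : is_expect (@pair_leb R nx) (mix k i j)
  (fun p => (yx y k (vec p.2) - Gm *m xu u k (vec p.1)) *m
            (yx y k (vec p.2) - Gm *m xu u k (vec p.1))^T) (scat k i j Gm).
Proof.
have hyy := is_expect_yy y cov_spd k i j.
have hxx := is_expect_xx u cov_spd k i j.
have hyx := is_expect_yx u y cov_spd k i j.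
have h1 := is_expect_mul Gm 1%:M (is_expect_tr hyx).
have h2 := is_expect_mul 1%:M Gm^T hyx.
have h3 := is_expect_mul Gm Gm^T hxx.
have := is_expectZD 1 1 (is_expectZD 1 (-1) (is_expectZD 1 (-1) hyy h1) h2) h3.
rewrite !scale1r !scaleN1r !mulmx1 !mul1mx -/(scat _ _ _ _).
set F := (F in is_expect _ _ F _); set H := (H in _ -> is_expect _ _ H _).
suff -> : F = H by [].
apply/funext => p; rewrite /F /H !scale1r !scaleN1r !mulmx1 !mul1mx.
set a := yx _ _ _; set b := xu _ _ _.
rewrite linearB/= mulmxBl !mulmxBr !trmx_mul trmxK opprB !mulmxA.
by rewrite -!addrA; congr (_ + _); rewrite [LHS]addrC -addrA.
Qed.

Lemma integral_log_emission k i j Gm P : spd P ->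
  (@pair_leb R nx).-integrable setT (fun p => (log_emission k Gm P p * mix k i j p)%:E) /\
  (\int[@pair_leb R nx]_p (log_emission k Gm P p * mix k i j p)%:E =
   (- (((\sum_(l < ncomp G k) wgt i j l) * ln ((2 * pi) ^+ (ny + nx) * \det P)
     + \tr (invmx P *m scat k i j Gm)) / 2))%:E)%E.
Proof.
move=> sP; have [im em] := integral_mixture_density wgt_ge0 cov_spd k i j.
have := is_expect_trace (is_expect_mul (invmx P) 1%:M (is_expect_residual k i j Gm)).
rewrite mulmx1 => -[it et].
set c := ln ((2 * pi) ^+ (ny + nx) * \det P).
have i1 := integrableZl measurableT (- (c / 2)) im.
have i2 := integrableZl measurableT (- 2^-1) it.
have E p : (((log_emission k Gm P p * mix k i j p)%:E) =
    (- (c / 2))%:E * (EFin \o mix k i j) p + (- 2^-1)%:E *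
    (\tr (invmx P *m ((yx y k (vec p.2) - Gm *m xu u k (vec p.1)) *m
            (yx y k (vec p.2) - Gm *m xu u k (vec p.1))^T) *m 1%:M) * mix k i j p)%:E)%E.
  rewrite /log_emission ln_gauss// -/c mulmx1 -!EFinM -EFinD; congr _%:E.
  by rewrite mulrDl; congr (_ + _); rewrite !mulNr; congr (- _); rewrite mulrAC mulrC mulrA.
split; first by apply: eq_integrable (integrableD measurableT i1 i2) => // p _; rewrite E.
under eq_integral do rewrite E.
rewrite integralD// !integralZl// et em -!EFinM -EFinD; congr _%:E.
by field.
Qed.

Lemma sum_log_emission i Gm P : spd P ->
  (\sum_(k < N) \sum_(j < m) \int[@pair_leb R nx]_p
     (log_emission k Gm P p * mix k i j p)%:E = (emission_score i Gm P)%:E)%E.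
Proof.
move=> sP; under eq_bigr do under eq_bigr do rewrite (integral_log_emission _ _ _ _ sP).2.
under eq_bigr do rewrite sumEFin.
rewrite sumEFin; congr _%:E; rewrite /emission_score.
have -> : scatter i Gm = \sum_(k < N) \sum_(j < m) scat k i j Gm.
  rewrite /scatter /scat.
  under [RHS]eq_bigr do rewrite big_split/= !sumrB -!mulmx_suml -!mulmx_sumr -raddf_sum/=.
  by rewrite big_split/= !sumrB -!mulmx_suml -!mulmx_sumr -raddf_sum/=.
rewrite /c_m mulr_suml mulmx_sumr raddf_sum/= -big_split/= mulr_suml -sumrN.
apply: eq_bigr => k _; rewrite mulr_suml mulmx_sumr raddf_sum/= -big_split/=.
by rewrite mulr_suml -sumrN.
Qed.

End emission_score.

(** * Decomposition of the Q-function *)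

Section decomposition.
Context (R : realType) (nx nu ny m N : nat).
Variables (u : 'I_N -> 'cV[R]_nu) (y : 'I_N -> 'cV[R]_ny).
Variable th' : params R nx nu ny m.
Variable G : mixtures R nx m N.
Hypothesis ath' : admissible th'.
Hypothesis evidence_gt0 : (0 < evidence u y th')%E.
Hypothesis mixtureG : joint_smoothed_mixture u y th' G.

Local Notation X := (euclid R nx).
Local Notation mix := (mixture_density G).
Local Notation post := (posterior u y th').
Local Notation mu := (leb_states R nx N).

Let wgt_ge0 : forall k i j (l : 'I_(ncomp G k)), 0 <= wgt i j l.
Proof. by case: mixtureG. Qed.

Let cov_spd : forall k i j (l : 'I_(ncomp G k)), spd (cov i j l).
Proof. by case: mixtureG. Qed.

Let pair_at (k : 'I_N) (x : states R nx N) : X * X := (tnth x (cur k), tnth x (nxt k)).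

Let measurable_pair_at k : measurable_fun [set: states R nx N] (pair_at k).
Proof. exact: measurable_fun_pair (measurable_tnth _) (measurable_tnth _). Qed.

Let post_ge0 x z : 0 <= post x z. Proof. exact: posterior_ge0. Qed.

Let integral_post_sum k i j A : measurable A ->
  (\int[mu]_(x in pair_at k @^-1` A)
     (\sum_(z : modes m N | (z (cur k) == i) && (z (nxt k) == j)) post x z)%:E =
   \int[@pair_leb R nx]_(p in A) (mix k i j p)%:E)%E.
Proof.
move=> mA; case: mixtureG => _ _ /(_ k i j A mA) <-.
have mB : measurable (pair_at k @^-1` A).
  by rewrite -[X in measurable X]setTI; exact: measurable_pair_at.
rewrite /joint_smoothed -[RHS]big_filter -ge0_integral_sum//.
- by apply: eq_integral => x _; rewrite -sumEFin -big_filter.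
- move=> z; apply/measurable_EFinP; apply: measurable_funTS.
  exact: measurable_posterior.
- by move=> z x _; rewrite lee_fin.
Qed.

(** The hypothesis covers measurable sets only. [ge0_integral_weighted_ext] extends it to
    non-negative [f], with the grouped posterior and the mixture density as weights, and the two
    parts of [f] give the rest. *)
Lemma integral_joint_smoothed k i j (f : X * X -> \bar R) :
  measurable_fun [set: X * X] f ->
  (\sum_(z : modes m N | (z (cur k) == i) && (z (nxt k) == j))
     \int[mu]_x (f (tnth x (cur k), tnth x (nxt k)) * (post x z)%:E) =
   \int[@pair_leb R nx]_p (f p * (mix k i j p)%:E))%E.
Proof.
move=> mf; rewrite (integral_sum_weights _ _ _ (f := f \o pair_at k)
  (g := fun z x => (post x z)%:E)); last 3 first.
- exact: (measurableT_comp mf (measurable_pair_at k)).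
- by move=> z; apply/measurable_EFinP; exact: measurable_posterior.
- by move=> z x; rewrite lee_fin.
under eq_integral do rewrite sumEFin.
set W := fun x : states R nx N =>
  \sum_(z : modes m N | (z (cur k) == i) && (z (nxt k) == j)) post x z.
have W0 x : 0 <= W x by exact: sumr_ge0.
have mW : measurable_fun [set: states R nx N] W.
  rewrite /W; under eq_fun do rewrite -big_filter.
  by apply: measurable_sum => z; exact: measurable_posterior.
have H (g : X * X -> \bar R) : measurable_fun [set: X * X] g -> (forall p, 0 <= g p)%E ->
    (\int[mu]_x (g (pair_at k x) * (W x)%:E) =
     \int[@pair_leb R nx]_p (g p * (mix k i j p)%:E))%E.
  move=> mg g0; apply: (ge0_integral_weighted_ext (psi := id)) => //.
  - exact: measurable_mixture_density.
  - by move=> p; exact: mixture_density_ge0.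
  - by move=> A mA; exact: integral_post_sum.
have W0' x : (0 <= (W x)%:E)%E by rewrite lee_fin.
have M0 p : (0 <= (mix k i j p)%:E)%E by rewrite lee_fin mixture_density_ge0.
rewrite (integralM_funeposneg _ (f \o pair_at k) W0') (integralM_funeposneg _ f M0).
rewrite funepos_comp funeneg_comp -!H//.
- exact: measurable_funeneg.
- exact: measurable_funepos.
Qed.

(** The mixture determines only a whole group of paths; for [|f|] all terms of the group are
    non-negative, so each single path is dominated by their sum. *)
Lemma integrable_joint_smoothed k (z : modes m N) (f : X * X -> R) :
  measurable_fun [set: X * X] f ->
  (@pair_leb R nx).-integrable setT
    (fun p => (f p * mix k (z (cur k)) (z (nxt k)) p)%:E) ->
  mu.-integrable setT (fun x => (f (pair_at k x) * post x z)%:E).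
Proof.
move=> mf /integrableP[_ fi]; apply/integrableP; split.
  apply/measurable_EFinP; apply: measurable_funM; last exact: measurable_posterior.
  exact: (measurableT_comp mf (measurable_pair_at k)).
pose F p : \bar R := `|f p|%:E.
have mF : measurable_fun [set: X * X] F.
  by apply/measurable_EFinP; exact: measurableT_comp.
apply: le_lt_trans fi.
have -> : (\int[@pair_leb R nx]_p `|(f p * mix k (z (cur k)) (z (nxt k)) p)%:E| =
    \int[@pair_leb R nx]_p (F p * (mix k (z (cur k)) (z (nxt k)) p)%:E))%E.
  apply: eq_integral => p _; rewrite /F -EFinM /= normrM.
  by rewrite (@ger0_norm _ (mix _ _ _ _))// mixture_density_ge0.
rewrite -integral_joint_smoothed// (bigD1 z) ?eqxx//=.
have -> : (\int[mu]_x `|(f (pair_at k x) * post x z)%:E| =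
    \int[mu]_x (F (pair_at k x) * (post x z)%:E))%E.
  by apply: eq_integral => x _; rewrite /F -EFinM /= normrM (ger0_norm (post_ge0 _ _)).
rewrite leeDl//; apply: sume_ge0 => w _; apply: integral_ge0 => x _.
by rewrite mule_ge0 ?lee_fin.
Qed.

Lemma sum_posterior_mass k i j :
  (\sum_(z : modes m N | (z (cur k) == i) && (z (nxt k) == j)) \int[mu]_x (post x z)%:E =
   (\sum_(l < ncomp G k) wgt i j l)%:E)%E.
Proof.
rewrite -(integral_mixture_density wgt_ge0 cov_spd k i j).2.
transitivity (\int[@pair_leb R nx]_p (cst 1 p * (mix k i j p)%:E))%E; last first.
  by apply: eq_integral => p _; rewrite mul1e.
rewrite -integral_joint_smoothed//.
by apply: eq_bigr => z _; apply: eq_integral => x _; rewrite mul1e.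
Qed.

Lemma sum_modes_pair (k : 'I_N) (F : modes m N -> \bar R) :
  (\sum_z F z = \sum_i \sum_j
    \sum_(z : modes m N | (z (cur k) == i) && (z (nxt k) == j)) F z)%E.
Proof.
rewrite (partition_big (fun z : modes m N => z (cur k)) predT)//=.
apply: eq_bigr => i _.
by rewrite (partition_big (fun z : modes m N => z (nxt k)) predT).
Qed.

Definition mode_score (i : 'I_m) (Gm : 'M[R]_(ny + nx, nx + nu)) (P : 'M[R]_(ny + nx))
    (t : 'cV[R]_m) : \bar R :=
  ((emission_score u y G i Gm P)%:E +
   \sum_j lne (t j ord0 / \sum_l t l ord0)%:E * (trans_weight G j i)%:E)%E.

Lemma Qfun_decomposition (th : params R nx nu ny m) : admissible th ->
  (Qfun u y th th' = init_score u y th' (init th) +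
   \sum_i mode_score i (Gam th i) (Pi th i) (col i (Tmx th)))%E.
Proof.
move=> [[mi i0 i1] T0 sP].
pose H k i := log_emission u y k (Gam th i) (Pi th i).
pose h (z : modes m N) x := \sum_(k < N) H k (z (cur k)) (pair_at k x).
pose L i j : \bar R := lne (Tmx th j i / \sum_l Tmx th l i)%:E.
have iH k (z : modes m N) : mu.-integrable setT (fun x => (H k (z (cur k)) (pair_at k x) * post x z)%:E).
  apply: integrable_joint_smoothed; first exact: measurable_log_emission.
  exact: (integral_log_emission u y wgt_ge0 cov_spd _ _ _ _ (sP _)).1.
have mH k i : measurable_fun [set: states R nx N] (fun x => H k i (pair_at k x)).
  exact: (measurableT_comp (measurable_log_emission _ _ _ _ _) (measurable_pair_at k)).
have ip (z : modes m N) : mu.-integrable setT (fun x => (post x z)%:E).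
  apply/integrableP; split; first by apply/measurable_EFinP; exact: measurable_posterior.
  under eq_integral do rewrite /= ger0_norm//.
  have /andP[_] := integral_posterior_le1 ath' evidence_gt0 z.
  by move/le_lt_trans; apply; exact: ltry.
have Loo i j : L i j != +oo%E by rewrite /L /lne; case: ifP.
(* Along a fixed mode path the transition logarithms form a constant, possibly [-oo], the emission
   terms are integrable, and only the initial term is unrestricted. *)
have E (z : modes m N) : (\int[mu]_x (ln_joint u y th x z * (post x z)%:E) =
    \int[mu]_x (lne (init th (tnth x ord0) (z ord0))%:E * (post x z)%:E) +
    \sum_(k < N) \int[mu]_x (H k (z (cur k)) (pair_at k x) * post x z)%:E +
    \sum_(k < N) L (z (cur k)) (z (nxt k)) * \int[mu]_x (post x z)%:E)%E.
  have pfin := integrable_fin_num measurableT (ip z).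
  have [<- Soo] := lt_pinfty_sume_distrl (index_enum 'I_N)
    (fun k => Loo (z (cur k)) (z (nxt k))) pfin.
  have eh x : ((h z x * post x z)%:E =
      \sum_(k < N) (H k (z (cur k)) (pair_at k x) * post x z)%:E)%E.
    by rewrite /h mulr_suml -sumEFin.
  have ihz : mu.-integrable setT (fun x => (h z x * post x z)%:E).
    apply: eq_integrable (integrable_sum measurableT _ (fun k _ => iH k z)) => //.
    by move=> x _; rewrite eh.
  have mhz : measurable_fun [set: states R nx N] (h z).
    by apply: measurable_sum => k; exact: mH.
  transitivity (\int[mu]_x ((lne (init th (tnth x ord0) (z ord0))%:E + (h z x)%:E +
      \sum_(k < N) L (z (cur k)) (z (nxt k))) * (post x z)%:E))%E.
    apply: eq_integral => x _; rewrite /ln_joint -addeA; congr ((_ + _) * _)%E.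
    rewrite big_split/= /h -sumEFin; congr (_ + _)%E; apply: eq_bigr => k _.
    by rewrite /emission leNgt gauss_gt0.
  rewrite integral_split_weighted//; last 2 first.
  - apply: measurable_lne_EFin.
    exact: (measurableT_comp (mi (z ord0)) (@measurable_tnth _ _ _ ord0)).
  - exact: ip.
  congr (_ + _ + _)%E; under eq_integral do rewrite eh.
  by rewrite integral_sum.
have split2 (A B : 'I_m -> \bar R) :
    (\sum_i (A i + B i) = \sum_i A i + \sum_i B i)%E by exact: big_split.
have split3 (A B C : modes m N -> \bar R) :
    (\sum_z (A z + B z + C z) = \sum_z A z + (\sum_z B z + \sum_z C z))%E.
  by rewrite 2!big_split/= addeA.
rewrite /Qfun; under eq_bigr do rewrite E.
rewrite split3; congr (_ + _)%E.
  rewrite /init_score -(sum_integral_smoothed1 ath' evidence_gt0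
    (F := fun z1 x1 => lne (init th x1 z1)%:E))//.
  by move=> z1; apply: measurable_lne_EFin; exact: mi.
rewrite /mode_score [RHS](split2 (fun i => (emission_score u y G i (Gam th i) (Pi th i))%:E)).
congr (_ + _)%E.
  rewrite exchange_big/=.
  under [RHS]eq_bigr do rewrite -(sum_log_emission u y wgt_ge0 cov_spd _ _ (sP _)).
  rewrite [RHS]exchange_big/=; apply: eq_bigr => k _.
  rewrite (sum_modes_pair k); apply: eq_bigr => i _; apply: eq_bigr => j _.
  rewrite -[RHS](integral_joint_smoothed k i j (f := EFin \o H k i)).
    by apply: eq_bigr => z /andP[/eqP -> _].
  by apply/measurable_EFinP; exact: measurable_log_emission.
rewrite exchange_big/=.
transitivity (\sum_(k < N) \sum_i \sum_j L i j * (\sum_(l < ncomp G k) wgt i j l)%:E)%E.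
  apply: eq_bigr => k _; rewrite (sum_modes_pair k).
  apply: eq_bigr => i _; apply: eq_bigr => j _; rewrite -sum_posterior_mass.
  (* [L i j] may be [-oo]; distributing it is lawful because the masses are non-negative. *)
  rewrite ge0_sume_distrr; last first.
    by move=> z _; apply: integral_ge0 => x _; rewrite lee_fin.
  by apply: eq_bigr => z /andP[/eqP -> /eqP ->].
rewrite exchange_big/=; apply: eq_bigr => i _.
rewrite exchange_big/=; apply: eq_bigr => j _.
rewrite -ge0_sume_distrr; last first.
  by move=> k _; rewrite lee_fin; apply: sumr_ge0 => l _.
rewrite sumEFin /L mxE; congr (lne (_ / _)%:E * _)%E.
by apply: eq_bigr => l _; rewrite mxE.
Qed.

End decomposition.

(** * Optimality of the updates *)

Section optimality.
Context (R : realType) (nx nu ny m N : nat).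
Variables (u : 'I_N -> 'cV[R]_nu) (y : 'I_N -> 'cV[R]_ny).
Variable G : mixtures R nx m N.
Hypothesis wgt_ge0 : forall k i j (l : 'I_(ncomp G k)), 0 <= wgt i j l.
Hypothesis cov_spd : forall k i j (l : 'I_(ncomp G k)), spd (cov i j l).
Implicit Types (Gm : 'M[R]_(ny + nx, nx + nu)) (P : 'M[R]_(ny + nx)) (z : 'I_m).

Lemma mix_expect_xx_sym k i j :
  (mix_expect G k i j (fun x _ => xu u k x *m (xu u k x)^T))^T =
  mix_expect G k i j (fun x _ => xu u k x *m (xu u k x)^T).
Proof.
have H := is_expect_xx u cov_spd k i j; apply/matrixP => a b.
apply/eqP; rewrite -eqe; apply/eqP.
rewrite -(H a b).2 -(is_expect_tr H a b).2; apply: eq_integral => p _.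
by rewrite trmx_mul trmxK.
Qed.

(** The form at [v] is the integral of the square of [v^T *m xu u k x] against the non-negative
    mixture density. *)
Lemma mix_expect_xx_quad_ge0 k i j v :
  0 <= quad (mix_expect G k i j (fun x _ => xu u k x *m (xu u k x)^T)) v.
Proof.
have H := is_expect_mul v^T v (is_expect_xx u cov_spd k i j).
rewrite -lee_fin /quad -(H ord0 ord0).2; apply: integral_ge0 => p _.
rewrite lee_fin mulr_ge0//; last exact: mixture_density_ge0.
rewrite mulmxA -mulmxA -{2}(trmxK v) -trmx_mul.
by rewrite mxE big_ord1 [_^T _ _]mxE -expr2 sqr_ge0.
Qed.

Lemma Sigma_sym z : (Sigma u G z)^T = Sigma u G z.
Proof.
rewrite /Sigma /mixture_sum raddf_sum; apply: eq_bigr => k _ /=.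
by rewrite raddf_sum; apply: eq_bigr => j _ /=; exact: mix_expect_xx_sym.
Qed.

Lemma quad_sum n (I : Type) (s : seq I) (A : I -> 'M[R]_n) v :
  quad (\sum_(i <- s) A i) v = \sum_(i <- s) quad (A i) v.
Proof. by rewrite /quad mulmx_sumr mulmx_suml summxE. Qed.

Lemma Sigma_quad_ge0 z v : 0 <= quad (Sigma u G z) v.
Proof.
rewrite /Sigma /mixture_sum quad_sum; apply: sumr_ge0 => k _.
rewrite quad_sum; apply: sumr_ge0 => j _; exact: mix_expect_xx_quad_ge0.
Qed.

(** Each diagonal entry is the value of the form [S] at a row of [A]. *)
Lemma trace_congr_ge0 n p (S : 'M[R]_n) (A : 'M[R]_(p, n)) :
  (forall v, 0 <= quad S v) -> 0 <= \tr (A *m S *m A^T).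
Proof.
move=> S0; apply: sumr_ge0 => i _; have := S0 (row i A)^T.
rewrite /quad trmxK; congr (0 <= _).
rewrite !mxE; apply: eq_bigr => k _; rewrite !mxE; congr (_ * _).
by apply: eq_bigr => l _; rewrite !mxE.
Qed.

Lemma scatter_update z Gm : Sigma u G z \in unitmx ->
  scatter u y G z Gm = scatter u y G z (Gam_update u y G z) +
    (Gm - Gam_update u y G z) *m Sigma u G z *m (Gm - Gam_update u y G z)^T.
Proof.
move=> uS; rewrite /scatter; set G0 := Gam_update u y G z.
(* The normal equation of the least-squares problem; it turns every cross term into a multiple of
   [Sigma]. *)
have -> : Psi u y G z = G0 *m Sigma u G z by rewrite mulmxKV.
have sS := Sigma_sym z; set S := Sigma u G z in sS *.
rewrite trmx_mul sS linearB/= !mulmxBl !mulmxBr !mulmxA.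
set a := Gm *m S *m G0^T; set b := G0 *m S *m Gm^T; set c := Gm *m S *m Gm^T.
set e := G0 *m S *m G0^T; set f := Phi y G z.
clearbody a b c e f.
by apply/matrixP => i j; rewrite !mxE; ring.
Qed.

(** The excess over the optimum is the trace of [invmx P] times [D *m S *m D^T], non-negative once
    [invmx P] is split as [B^T *m B]. The optimal [Gm] is the same for every [P], which is why it
    survives a fixed [P]. *)
Lemma emission_score_Gam_update z Gm P : spd P -> Sigma u G z \in unitmx ->
  emission_score u y G z Gm P <= emission_score u y G z (Gam_update u y G z) P.
Proof.
move=> sP uS; rewrite /emission_score lerN2 ler_pM2r ?invr_gt0// lerD2l.
rewrite (scatter_update Gm uS); set s := scatter _ _ _ _ (Gam_update _ _ _ _).
clearbody s; rewrite mulmxDr mxtraceD lerDl.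
have [B uB ->] := cholesky (spd_inv sP).
set D := Gm - _; set S := Sigma u G z.
have -> : \tr (B^T *m B *m (D *m S *m D^T)) = \tr (B *m D *m S *m (B *m D)^T).
  by rewrite trmx_mul -!mulmxA [LHS]mxtrace_mulC -!mulmxA.
by apply: trace_congr_ge0; exact: Sigma_quad_ge0.
Qed.

Lemma emission_score_Pi_update z Gm P : 0 < c_m G z -> spd P ->
  spd (Pi_update u y G z Gm) ->
  emission_score u y G z Gm P <= emission_score u y G z Gm (Pi_update u y G z Gm).
Proof.
move=> c0 sP; have E : scatter u y G z Gm = c_m G z *: Pi_update u y G z Gm.
  by rewrite /Pi_update scalerA divff ?gt_eqF// scale1r.
set Q := Pi_update u y G z Gm in E *; move=> sQ; clearbody Q.
have K0 : 0 < (2 * pi) ^+ (ny + nx) :> R by rewrite exprn_gt0// mulr_gt0 ?pi_gt0.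
rewrite /emission_score lerN2 ler_pM2r ?invr_gt0// E -!scalemxAr !linearZ/= -!mulrDr.
rewrite ler_pM2l// !lnM ?posrE ?spd_det_gt0// mulVmx ?spd_unit// mxtrace1.
(* [invmx P *m Q] is not symmetric in general; [B *m Q *m B^T] is, and has the same trace and
   determinant. The bound [ln_det_le_trace] is applied to it. *)
have [B uB PB] := cholesky (spd_inv sP).
have sW : spd (B^T^T *m Q *m B^T) by apply: spd_congr => //; rewrite unitmx_tr.
have := ln_det_le_trace sW; rewrite trmxK mxtrace_mulC mulmxA -PB.
have -> : \det (B *m Q *m B^T) = \det Q / \det P.
  rewrite -det_inv PB !det_mulmx det_tr; ring.
by rewrite ln_div ?posrE ?spd_det_gt0//; lra.
Qed.

Lemma trans_weight_ge0 j z : 0 <= trans_weight G j z.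
Proof. by apply: sumr_ge0 => k _; apply: sumr_ge0 => l _. Qed.

Lemma sum_trans_weight z : \sum_j trans_weight G j z = c_m G z.
Proof. by rewrite /trans_weight exchange_big. Qed.

Lemma transition_score_update z (t t2 : 'cV[R]_m) : 0 < c_m G z ->
  (forall j, t j ord0 = trans_weight G j z / c_m G z) -> (forall j, 0 <= t2 j ord0) ->
  (\sum_j lne (t2 j ord0 / \sum_l t2 l ord0)%:E * (trans_weight G j z)%:E <=
   \sum_j lne (t j ord0 / \sum_l t l ord0)%:E * (trans_weight G j z)%:E)%E.
Proof.
move=> c0 tE t20; set c := c_m G z in c0 tE *; have cN0 : c != 0 by rewrite gt_eqF.
have t1 : \sum_l t l ord0 = 1.
  by under eq_bigr do rewrite tE; rewrite -mulr_suml sum_trans_weight divff.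
have t0 j : 0 <= t j ord0 by rewrite tE divr_ge0 ?trans_weight_ge0// ltW.
pose p j := t2 j ord0 / \sum_l t2 l ord0.
have p0 j : 0 <= p j by rewrite divr_ge0 ?sumr_ge0.
(* A zero column of [t2] normalises to zero, as division by 0 gives 0, so only [<= 1] holds; this is
   the direction needed. *)
have p1 : \sum_j p j <= 1.
  rewrite /p -mulr_suml; have [->|s0] := eqVneq (\sum_l t2 l ord0) 0.
    by rewrite mul0r.
  by rewrite divff.
apply: (@le_trans _ _ (\sum_j (lne (t j ord0 / \sum_l t l ord0)%:E *
    (trans_weight G j z)%:E + ((p j - t j ord0) * c)%:E))%E).
  apply: lee_sum => j _; rewrite t1 divr1.
  have -> : trans_weight G j z = t j ord0 * c by rewrite tE divfK.
  rewrite (EFinM (t j ord0)) (EFinM (p j - _)) !muleA -muleDl ?fin_num_adde_defl//.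
  by apply: lee_wpmul2r; [rewrite lee_fin ltW|exact: (gibbs_pointwise (p0 j) (t0 j))].
rewrite big_split/= -[leRHS]adde0 leeD2l// sumEFin lee_fin -mulr_suml sumrB t1.
by rewrite mulr_le0_ge0// ?subr_le0// ltW.
Qed.

End optimality.

Lemma restricted_update_is_maximiser (R : realType) (nx nu ny m N : nat)
    (u : 'I_N -> 'cV[R]_nu) (y : 'I_N -> 'cV[R]_ny) (th' : params R nx nu ny m)
    (G : mixtures R nx m N) (fI : bool) (fG fP fT : {set 'I_m})
    (th0 th : params R nx nu ny m) :
  admissible th' -> (0 < evidence u y th')%E -> joint_smoothed_mixture u y th' G ->
  admissible th0 -> agrees fI fG fP fT th0 th ->
  (~~ fI -> forall x z, init th x z = smoothed1 u y th' x z) ->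
  (forall z, z \notin fG ->
     Sigma u G z \in unitmx /\ Gam th z = Gam_update u y G z) ->
  (forall z, z \notin fP ->
     [/\ 0 < c_m G z, Pi th z = Pi_update u y G z (Gam th z) & spd (Pi th z)]) ->
  (forall z, z \notin fT ->
     0 < c_m G z /\ forall zs, Tmx th zs z = trans_weight G zs z / c_m G z) ->
  is_maximiser [set t | admissible t /\ agrees fI fG fP fT th0 t]
    (fun t => Qfun u y t th') th.
Proof.
move=> ath' ev mG ath0 agr hI hG hP hT.
have [w0 sC _] := mG; have [d0 T00 P00] := ath0; have [aI aG aP aT] := agr.
have initE : ~~ fI -> init th = smoothed1 u y th'.
  by move=> /hI h; apply/funext => x; apply/funext => z; exact: h.
have spdP z : spd (Pi th z).
  have [/aP ->//|/hP[]//] := boolP (z \in fP).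
have ath : admissible th.
  split => //.
  - have [/aI ->//|/initE ->] := boolP fI; exact: smoothed1_density.
  - move=> j i; have [/aT|/hT[c0 ->]] := boolP (i \in fT).
      by move/(congr1 (fun M : 'cV_m => M j ord0)); rewrite !mxE => ->.
    by rewrite divr_ge0 ?trans_weight_ge0// ltW.
split; first by split.
move=> th2 [ath2 [bI bG bP bT]]; have [d2 T2 P2] := ath2.
rewrite !(Qfun_decomposition ath' ev mG)//; apply: leeD.
  have [fIt|/initE ->] := boolP fI; first by rewrite aI// bI.
  exact: init_score_le.
apply: lee_sum => z _; apply: leeD.
  (* [Gam] is improved first, at the competitor's [Pi]; then [Pi] is improved at the [Gam] of [th],
     the one inserted in its update. *)
  rewrite lee_fin; apply: (@le_trans _ _ (emission_score u y G z (Gam th z) (Pi th2 z))).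
    have [zG|/hG[uS ->]] := boolP (z \in fG); first by rewrite aG// bG.
    exact: emission_score_Gam_update.
  have [zP|/hP[c0 PE sP]] := boolP (z \in fP); first by rewrite aP// bP.
  by rewrite PE; apply: emission_score_Pi_update => //; rewrite -PE.
have [zT|/hT[c0 TE]] := boolP (z \in fT); first by rewrite aT// bT.
by refine (transition_score_update w0 c0 _ _) => j; rewrite mxE.
Qed.

Theorem lemma3p3 (R : realType) (nx nu ny m N : nat)
    (u : 'I_N -> 'cV[R]_nu) (y : 'I_N -> 'cV[R]_ny)
    (th' : params R nx nu ny m) (G : mixtures R nx m N) :
  (0 < N)%N ->
  admissible th' ->
  (0 < evidence u y th')%E ->
  joint_smoothed_mixture u y th' G ->
  [/\ forall th : params R nx nu ny m,
        (forall z, 0 < c_m G z) ->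
        (forall z, Sigma u G z \in unitmx) ->
        (forall z, spd (Pi th z)) ->
        (forall x z, init th x z = smoothed1 u y th' x z) ->
        (forall z, Gam th z = Gam_update u y G z) ->
        (forall z, Pi th z = Pi_update u y G z (Gam th z)) ->
        (forall zs z, Tmx th zs z = trans_weight G zs z / c_m G z) ->
        is_maximiser (@admissible R nx nu ny m) (fun t => Qfun u y t th') th,

      forall (fI : bool) (fG fP fT : {set 'I_m}) (th0 th : params R nx nu ny m),
        admissible th0 ->
        agrees fI fG fP fT th0 th ->
        (~~ fI -> forall x z, init th x z = smoothed1 u y th' x z) ->
        (forall z, z \notin fG ->
           Sigma u G z \in unitmx /\ Gam th z = Gam_update u y G z) ->
        (forall z, z \notin fP ->
           [/\ 0 < c_m G z, Pi th z = Pi_update u y G z (Gam th z)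
             & spd (Pi th z)]) ->
        (forall z, z \notin fT ->
           0 < c_m G z /\ forall zs, Tmx th zs z = trans_weight G zs z / c_m G z) ->
        is_maximiser [set t | admissible t /\ agrees fI fG fP fT th0 t]
          (fun t => Qfun u y t th') th
    & exists (q0 : (euclid R nx -> 'I_m -> R) -> \bar R)
             (q : 'I_m -> 'M[R]_(ny + nx, nx + nu) -> 'M[R]_(ny + nx) ->
                  'cV[R]_m -> \bar R),
        forall th : params R nx nu ny m, admissible th ->
          (Qfun u y th th' =
           q0 (init th) + \sum_z q z (Gam th z) (Pi th z) (col z (Tmx th)))%E].
Proof.
move=> _ ath' ev mG; split.
- move=> th c0 uS sP hI hG hP hT.
  (* The full update is the restricted one with nothing held fixed; [th'] merely fills the place of
     the reference parameters. *)
  have [] := @restricted_update_is_maximiser R nx nu ny m N u y th' G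
    false finset.set0 finset.set0 finset.set0 th' th ath' ev mG ath'.
  + by split=> // z; rewrite finset.inE.
  + by move=> _.
  + by move=> z _.
  + by move=> z _; split.
  + by move=> z _; split.
  move=> [ath _] H; split=> // th2 ath2; apply: H; split=> //.
  by split=> // z; rewrite finset.inE.
- by move=> fI fG fP fT th0 th; exact: restricted_update_is_maximiser.
- exists (init_score u y th'), (mode_score u y G) => th ath.
  exact: Qfun_decomposition.
Qed.
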